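(* Let $X$ be a separable real normed space that admits a separating polynomial, let $Y$ be a real Banach space, let $A \subset X$ be any subset, let $f: A \to Y$ be a continuous function (with $A$ carrying the subspace topology), and let $\varepsilon > 0$. Then there are an open subset $A_\varepsilon$ of $X$ with $A_\varepsilon \supset A$ and an analytic function $f_\varepsilon : A_\varepsilon \to Y$ such that $\|f(x) - f_\varepsilon(x)\| < \varepsilon$ for all $x \in A$.
   Context: Let $X, Y$ be real normed spaces ($X$ is not assumed complete). A continuous $n$-homogeneous polynomial $F_n : X \to Y$ is a continuous map of the form $F_n(x) = B_n(x,\dots,x)$ with $B_n : X^n \to Y$ an $n$-linear map ($F_0$ is a constant map). A polynomial $P : X \to Y$ is a finite sum of continuous homogeneous polynomials. A separating polynomial on the real normed space $X$ is a polynomial $P : X \to \mathbb{R}$ such that $P(0) = 0$ and $\inf_{\|x\|=1} P(x) > 0$. A map $H : G \to Y$ on an open set $G \subset X$ is analytic if every point $a \in G$ has a neighborhood $V \subset G$ and continuous $n$-homogeneous polynomials $F_n : X \to Y$ ($n \ge 0$) such that $H(x) = \sum_{n=0}^\infty F_n(x-a)$ for all $x \in V$, the series converging uniformly on $V$ with respect to the norm of $Y$. *)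

(* Defs.v *)
From mathcomp Require Import all_boot all_order all_algebra.
From mathcomp Require Import all_classical all_reals all_analysis.

Set Implicit Arguments.
Unset Strict Implicit.
Unset Printing Implicit Defensive.

Import Order.TTheory GRing.Theory Num.Theory.
Import numFieldNormedType.Exports.

Local Open Scope classical_set_scope.
Local Open Scope ring_scope.

Definition separable (T : topologicalType) : Prop :=
  exists2 D : set T, countable D & dense D.

Section Polynomials.
Context {R : realType} {X Y : normedModType R}.

Definition multilinear (n : nat) (B : {ffun 'I_n -> X} -> Y) : Prop :=
  forall (i : 'I_n) (v : {ffun 'I_n -> X}),
    linear (fun x : X => B [ffun j => if j == i then x else v j]).

(* Only the polynomial F is required to be continuous, not the n-linear map B
   inducing it. For n = 0, multilinearity is vacuous and F is constant. *)
Definition homogeneous_polynomial (n : nat) (F : X -> Y) : Prop :=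
  continuous F /\
  exists2 B : {ffun 'I_n -> X} -> Y,
    multilinear B & forall x, F x = B [ffun=> x].

Definition polynomial_map (P : X -> Y) : Prop :=
  exists (m : nat) (deg : 'I_m -> nat) (F : 'I_m -> X -> Y),
    (forall i, homogeneous_polynomial (deg i) (F i)) /\
    forall x, P x = \sum_(i < m) F i x.

(* The function H is total, but only its values on G matter. *)
Definition analytic_on (G : set X) (H : X -> Y) : Prop :=
  forall a, G a ->
    exists V : set X, [/\ nbhs a V, V `<=` G &
      exists F : nat -> X -> Y,
        (forall n, homogeneous_polynomial n (F n)) /\
        {uniform V, (fun N x => [series F n (x - a)]_n N) @ \oo --> H}].

End Polynomials.

(* The infimum is taken in the extended reals, so that it is +oo when the unit
   sphere is empty, i.e., when X is the zero space. *)
Definition separating_polynomial (R : realType) (X : normedModType R)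
    (P : X -> R^o) : Prop :=
  [/\ polynomial_map P, P 0 = 0 &
      (0 < ereal_inf [set (P x)%:E | x in [set x : X | `|x|%R = 1%R]])%E].

(* Main.v *)
Require Import Defs.
From mathcomp Require Import all_boot all_order all_algebra.
From mathcomp Require Import all_classical all_reals all_analysis.
From mathcomp Require Import ring lra zify.
Import Order.TTheory GRing.Theory Num.Theory.
Import numFieldNormedType.Exports.
Local Open Scope classical_set_scope.
Local Open Scope ring_scope.

(** A sum of squares of the homogeneous parts of the separating polynomial is a
    polynomial q >= 0 vanishing at 0 and bounded away from 0 off every ball around 0.
    Rescaled translates q_n of q (with centres in a countable dense set) give sets
    {q_n < t_n} covering A such that f is nearly a constant y_n on A /\ {q_n < 2 t_n}.
    The approximation is the quotient (sum_n psi_n y_n) / (sum_n psi_n) with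
      psi_n(x) = sum_y exp(kappa_n (s_n - sum_(j <= n) (q_j(x) - y_j)^2)),
    where y runs through a finite net of the box in R^(n+1) that describes the layer
    {q_n < t_n, q_j >= t_j for j < n}. With kappa_n large, psi_n is large on its layer
    (so that the denominator beats the unbounded values of f there) and negligible off
    {q_n < 2 t_n}. Near a point of {q_j < t_j} every net of index n > j lies at a positive
    distance, so psi_n decays there like exp(- kappa_n delta).
    Analyticity of the sums needs this decay for Taylor coefficients rather than for
    values. No complexification is used: functions are measured by the weighted l^1 norm
    sum_k M_k r^k of bounds M_k for their homogeneous parts at a point, which is
    submultiplicative and complete. The q_n are scaled so that the squared norms of the
    increments q_n - q_n(x0) have a small sum, which makes the radius r uniform in n. *)

(** * Bounded multilinear forms *)

Section Forms.
Set Implicit Arguments.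
Unset Strict Implicit.
Unset Printing Implicit Defensive.
Context {R : realType} {X : normedModType R}.
Implicit Types (Y : normedModType R) (w : nat -> X).

Definition upd w (i : nat) (x : X) : nat -> X := fun j => if j == i then x else w j.

(* An n-linear form reads the entries 0, ..., n - 1 of a sequence, so that products
   and partial evaluations need no cast between ordinal types. *)
Definition mform Y (n : nat) (M : R) (b : (nat -> X) -> Y) : Prop :=
  [/\ 0 <= M,
      forall w w', (forall i, (i < n)%N -> w i = w' i) -> b w = b w',
      forall i w, (i < n)%N -> linear (fun x => b (upd w i x)) &
      forall w, `|b w| <= M * \prod_(i < n) `|w i|].

(** The bound is carried by the form and is any admissible constant, not the optimal one, so that
    bounds simply add and multiply. It also survives the expansion at another point, which a bound
    on the diagonal alone would not give directly. *)
Definition hpoly Y (n : nat) (M : R) (F : X -> Y) : Prop :=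
  exists2 b : (nat -> X) -> Y, mform n M b & forall x, F x = b (fun=> x).

Lemma mformW Y n (M M' : R) (b : (nat -> X) -> Y) :
  M <= M' -> mform n M b -> mform n M' b.
Proof.
move=> MM' [M0 loc lin bd]; split => //; first exact: le_trans MM'.
move=> w; apply: le_trans (bd w) _.
by rewrite ler_wpM2r // prodr_ge0.
Qed.

Lemma hpoly_ge0 Y n (M : R) (F : X -> Y) : hpoly n M F -> 0 <= M.
Proof. by case=> b []. Qed.

Lemma hpoly_bound Y n (M : R) (F : X -> Y) x : hpoly n M F -> `|F x| <= M * `|x| ^+ n.
Proof.
case=> b [_ _ _ bd] ->; apply: le_trans (bd _) _.
by rewrite prodr_const card_ord.
Qed.

Lemma hpoly_0 Y n (M : R) (F : X -> Y) : hpoly n.+1 M F -> F 0 = 0.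
Proof.
move=> /(hpoly_bound 0); rewrite normr0 exprS mul0r mulr0 normr_le0.
by move/eqP.
Qed.

Lemma hpoly_0_cst Y (M : R) (F : X -> Y) x : hpoly 0 M F -> F x = F 0.
Proof. by case=> b [_ loc _ _] Fb; rewrite !Fb; apply: loc. Qed.

Lemma hpoly_cst Y (y : Y) : hpoly 0 `|y| (fun=> y).
Proof.
exists (fun=> y) => //; split => // w.
by rewrite big_ord0 mulr1.
Qed.

Lemma mform0 Y n : mform n 0 (fun=> 0 : Y).
Proof.
split => // [i w _ a x y|w]; first by rewrite scaler0 addr0.
by rewrite normr0 mul0r.
Qed.

Lemma hpoly0 Y n : hpoly n 0 (fun=> 0 : Y).
Proof. by exists (fun=> 0) => //; exact: mform0. Qed.

Lemma mformD Y n (M M' : R) (b b' : (nat -> X) -> Y) :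
  mform n M b -> mform n M' b' -> mform n (M + M') (fun w => b w + b' w).
Proof.
case=> M0 loc lin bd [M0' loc' lin' bd']; split.
- exact: addr_ge0.
- by move=> w w' ww'; rewrite (loc _ _ ww') (loc' _ _ ww').
- by move=> i w ni a x y; rewrite lin // lin' // scalerDr addrACA.
- by move=> w; rewrite mulrDl (le_trans (ler_normD _ _)) // lerD.
Qed.

Lemma hpolyD Y n (M M' : R) (F F' : X -> Y) :
  hpoly n M F -> hpoly n M' F' -> hpoly n (M + M') (fun x => F x + F' x).
Proof.
move=> [b bf Fb] [b' bf' Fb']; exists (fun w => b w + b' w).
  exact: mformD.
by move=> x; rewrite Fb Fb'.
Qed.

Lemma hpolyM Y m n (M N : R) (c : X -> R^o) (F : X -> Y) :
  hpoly m M c -> hpoly n N F -> hpoly (m + n) (M * N) (fun x => (c x : R) *: F x).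
Proof.
move=> [b [M0 loc lin bd] cb] [b' [N0 loc' lin' bd'] Fb'].
exists (fun w => (b w : R) *: b' (fun i => w (m + i)%N)); last first.
  by move=> x; rewrite cb Fb'.
split.
- exact: mulr_ge0.
- move=> w w' ww'; rewrite (loc w w') ?(loc' (fun i => w (m + i)%N) (fun i => w' (m + i)%N)) //.
    by move=> i ni; apply: ww'; rewrite ltn_add2l.
  by move=> i mi; apply: ww'; rewrite ltn_addr.
- move=> i w imn a x y /=.
  have [im|mi] := ltnP i m.
    have E z : b' (fun j => upd w i z (m + j)%N) = b' (fun j => w (m + j)%N).
      by apply: loc' => j _; rewrite /upd; case: eqP => // ?; lia.
    by rewrite !E lin // scalerDl scalerA.
  have E z : b (upd w i z) = b w.
    by apply: loc => j jm; rewrite /upd; case: eqP => // ?; lia.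
  have E' z : (fun j => upd w i z (m + j)%N) = upd (fun j => w (m + j)%N) (i - m) z.
    apply/funext => j; rewrite /upd; congr (if _ then _ else _).
    by apply/eqP/eqP; lia.
  rewrite !E !E' lin'; last by lia.
  by rewrite scalerDr !scalerA mulrC.
- move=> w; rewrite normrZ big_split_ord /= mulrACA.
  by apply: ler_pM => //; exact: bd'.
Qed.

(* The slots below p are parameters; only the slots p, ..., p + n - 1 are
   expanded at a + v. *)
Lemma mform_expand Y n : forall p (M : R) (b : (nat -> X) -> Y) (a : X),
  mform (p + n) M b -> exists c : nat -> (nat -> X) -> Y,
    (forall k, mform (p + k) (M * (1 + `|a|) ^+ n) (c k)) /\
    forall w v, b (fun i => if (i < p)%N then w i else a + v) =
      \sum_(0 <= k < n.+1) c k (fun i => if (i < p)%N then w i else v).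
Proof.
elim: n => [|n IH] p M b a bf.
  exists (fun k => if k == 0 then b else fun=> 0); split.
    case=> [|k] /=; first by rewrite expr0 mulr1.
    rewrite expr0 mulr1; apply: (@mformW _ _ 0); last exact: mform0.
    by case: bf.
  move=> w v; rewrite big_nat1 /=; case: bf => _ loc _ _.
  by apply: loc => i; rewrite addn0 => ->.
(* Slot [p] is first treated as one more parameter; linearity in that slot then separates [a] from
   [v]. *)
have [c [cf cE]] := IH p.+1 M b a (ltac:(by rewrite addSnnS)).
set K := M * (1 + `|a|) ^+ n in cf.
have K0 : 0 <= K by case: (cf 0).
(* [arg] inserts [a] at slot [p] and shifts the later entries. The new form of degree [k] has either
   [a] or [v] in slot [p]; the guard [k <= n] makes the first kind vanish in the top degree
   [n.+1]. *)
pose arg w := fun i => if i == p then a else w (unbump p i).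
exists (fun k w => (if (k <= n)%N then c k (arg w) else 0) +
                   (if k is k'.+1 then c k' w else 0)).
split.
  move=> k; have -> : M * (1 + `|a|) ^+ n.+1 = K * `|a| + K.
    by rewrite /K exprS; ring.
  apply: mformD; last first.
    case: k => [|k]; last by rewrite -addSnnS.
    exact: mformW K0 (mform0 _ _).
  case: (k <= n)%N; last first.
    by apply: (@mformW _ _ 0); [rewrite mulr_ge0|exact: mform0].
  have [_ loc lin bd] := cf k; split.
  - by rewrite mulr_ge0.
  - move=> w w' ww'; apply: loc => i ik; rewrite /arg; case: eqP => // ip.
    by apply: ww'; rewrite /unbump; move: ik ip; case: ltnP => /= ? ? ?; lia.
  - move=> i w ik.
    have E z : arg (upd w i z) = upd (arg w) (bump p i) z.
      apply/funext => j; rewrite /arg /upd; case: eqP => [->|/eqP jp].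
        by rewrite (negbTE (neq_bump _ _)).
      rewrite -(inj_eq (can_inj (bumpK p))) unbumpK //.
    move=> u x y; rewrite !E lin //.
    by rewrite /bump; case: (p <= i)%N; rewrite /= ?add1n ?add0n; lia.
  - move=> w; apply: le_trans (bd _) _; rewrite -mulrA ler_wpM2l //.
    have pk : (p < (p.+1 + k))%N by lia.
    rewrite (bigD1_ord (Ordinal pk)) //= /arg eqxx ler_wpM2l //.
    apply: ler_prod => i _ /=; rewrite eq_sym (negbTE (neq_bump _ _)) bumpK.
    by rewrite normr_ge0 lexx.
move=> w v.
set z := fun i => if (i < p)%N then w i else v.
have -> : (fun i => if (i < p)%N then w i else a + v) =
    (fun i => if (i < p.+1)%N then upd w p (a + v) i else a + v).
  apply/funext => i; rewrite /upd; case: (ltngtP i p) => ip.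
  - by rewrite ltnS ltnW.
  - by rewrite ltnS leqNgt ip.
  - by rewrite ip ltnSn.
rewrite cE.
have Ez k : c k (fun i => if (i < p.+1)%N then upd w p (a + v) i else v) =
    c k (arg z) + c k z.
  have [_ loc lin _] := cf k.
  have -> : (fun i => if (i < p.+1)%N then upd w p (a + v) i else v) =
      upd z p (1 *: a + v).
    apply/funext => i; rewrite /upd /z scale1r; case: (ltngtP i p) => ip.
    - by rewrite ltnS ltnW.
    - by rewrite ltnS leqNgt ip.
    - by rewrite ip ltnSn.
  rewrite lin; last by lia.
  rewrite scale1r; congr (c k _ + c k _); apply/funext => i.
    rewrite /upd /arg /z; case: eqP => // /eqP ip.
    rewrite /unbump; case: (ltngtP i p) => ip' //=.
    - by rewrite subn0 ip'.
    - by case: ifP => //; lia.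
    - by rewrite ip' eqxx in ip.
  by rewrite /upd /z; case: eqP => // ->; rewrite ltnn.
under eq_bigr do rewrite Ez.
rewrite big_split /= [RHS]big_split /=; congr (_ + _).
  rewrite [RHS]big_nat_recr //= ltnn addr0 big_nat_cond [RHS]big_nat_cond.
  by apply: eq_bigr => i /andP[/andP[_ iN] _]; rewrite -ltnS iN.
by rewrite [RHS]big_nat_recl //= add0r.
Qed.

Lemma hpoly_expand Y n (M : R) (F : X -> Y) (a : X) : hpoly n M F ->
  exists G : nat -> X -> Y,
    (forall k, hpoly k (M * (1 + `|a|) ^+ n) (G k)) /\
    forall v, F (a + v) = \sum_(0 <= k < n.+1) G k v.
Proof.
move=> [b bf Fb].
have [c [cf cE]] := @mform_expand Y n 0 M b a bf.
exists (fun k v => c k (fun=> v)); split => [k|v].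
  by exists (c k) => //; exact: cf.
by rewrite Fb (cE (fun=> 0) v).
Qed.

(** In the expansion at [a] the constant term is [F a], and each of the [n] others is at most K |v|
    when |v| <= 1. *)
Lemma hpoly_continuous Y n (M : R) (F : X -> Y) : hpoly n M F -> continuous F.
Proof.
move=> homF a; have [G [homG FE]] := @hpoly_expand Y n M F a homF.
set K := M * _ in homG.
have K0 : 0 <= K := hpoly_ge0 (homG 0).
have G0 : G 0 0 = F a.
  rewrite -[a]addr0 FE big_nat_recl //= big1_seq ?addr0 // => k _.
  exact: hpoly_0 (homG k.+1).
have bd v : `|v| <= 1 -> `|F (a + v) - F a| <= K *+ n * `|v|.
  move=> v1; rewrite FE big_nat_recl //= (hpoly_0_cst v (homG 0)) G0 addrC addKr.
  apply: le_trans (ler_norm_sum _ _ _) _.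
  rewrite mulrnAl -[n in X in _ <= X]subn0 -sumr_const_nat.
  apply: ler_sum => k _; apply: le_trans (hpoly_bound _ (homG _)) _.
  rewrite ler_wpM2l // exprS ler_piMr // exprn_ile1 //.
apply/cvgrPdist_le => e e0.
have d0 : 0 < Num.min 1 (e / (K *+ n + 1)).
  by rewrite lt_min ltr01 divr_gt0 // ltr_wpDl // mulrn_wge0.
near=> x.
have : `|a - x| <= Num.min 1 (e / (K *+ n + 1)).
  by near: x; apply: cvgr_dist_le => //; exact: cvg_id.
rewrite le_min => /andP[x1 x2].
rewrite -(subrKC a x) distrC.
rewrite distrC in x1 x2.
apply: le_trans (bd _ x1) _.
apply: (@le_trans _ _ ((K *+ n + 1) * `|x - a|)).
  by rewrite ler_wpM2r // lerDl.
rewrite mulrC -ler_pdivlMr // ltr_wpDl // mulrn_wge0 //.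
Unshelve. all: by end_near. Qed.

Lemma hpoly_homogeneous Y n (M : R) (F : X -> Y) :
  hpoly n M F -> homogeneous_polynomial n F.
Proof.
move=> homF; split; first exact: hpoly_continuous homF.
case: homF => b [_ loc lin _] Fb.
(* A finite family is padded with zeros to a sequence. *)
exists (fun w : {ffun 'I_n -> X} => b (fun i => oapp w 0 (insub i))); last first.
  by move=> x; rewrite Fb; apply: loc => i ni; rewrite insubT /= ffunE.
move=> i v a x y.
have E z : b (fun k => oapp [ffun j => if j == i then z else v j] 0 (insub k)) =
    b (upd (fun k => oapp v 0 (insub k)) i z).
  apply: loc => k kn; rewrite /upd insubT /= ffunE.
  by rewrite -(inj_eq val_inj).
by rewrite !E lin.
Qed.

End Forms.

(** * Polarization *)

Section Polarization.
Set Implicit Arguments.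
Unset Strict Implicit.
Unset Printing Implicit Defensive.
Context {R : realType} {X Y : normedModType R} {n : nat}.
Implicit Types (B : {ffun 'I_n -> X} -> Y) (v : {ffun 'I_n -> X}).

Definition fupd v (i : 'I_n) (x : X) : {ffun 'I_n -> X} :=
  [ffun j => if j == i then x else v j].

Lemma multilinear_sum B v i (I : finType) (u : I -> X) : multilinear B ->
  B (fupd v i (\sum_k u k)) = \sum_k B (fupd v i (u k)).
Proof.
move=> /(_ i v) lin.
have f0 : B (fupd v i 0) = 0.
  have := lin 1 0 0; rewrite !scale1r addr0 => /eqP.
  by rewrite -subr_eq subrr => /eqP.
apply: (big_morph (fun x => B (fupd v i x))) => // x y.
by have := lin 1 x y; rewrite !scale1r.
Qed.

Lemma multilinear_scale B v i (a : R) (x : X) : multilinear B ->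
  B (fupd v i (a *: x)) = a *: B (fupd v i x).
Proof.
move=> /(_ i v) lin.
have f0 : B (fupd v i 0) = 0.
  have := lin 1 0 0; rewrite !scale1r addr0 => /eqP.
  by rewrite -subr_eq subrr => /eqP.
by have := lin a x 0; rewrite addr0 [X in _ + X]f0 addr0.
Qed.

Lemma multilinear_scale_all B (c : 'I_n -> R) (u : 'I_n -> X) : multilinear B ->
  B [ffun j => c j *: u j] = (\prod_j c j) *: B [ffun j => u j].
Proof.
move=> linB.
have H m : (m <= n)%N ->
    B [ffun j : 'I_n => if (j < m)%N then c j *: u j else u j] =
    (\prod_(j < n | (j < m)%N) c j) *: B [ffun j => u j].
  elim: m => [_|m IH mn].
    by rewrite big_pred0_eq scale1r; congr B; apply/ffunP => j; rewrite !ffunE.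
  pose m' := Ordinal mn.
  rewrite (bigD1 m') //= -scalerA (eq_bigl (fun j : 'I_n => (j < m)%N)); last first.
    by move=> j; rewrite -(inj_eq val_inj) /= ltnS andbC; case: ltngtP.
  rewrite -IH; last exact: ltnW.
  set v := [ffun j : 'I_n => if (j < m)%N then _ else _].
  have -> : v = fupd v m' (u m').
    apply/ffunP => j; rewrite !ffunE; case: eqP => // ->.
    by rewrite /= ltnn.
  rewrite -multilinear_scale //; congr B; apply/ffunP => j; rewrite !ffunE.
  case: eqP => [->|/eqP]; first by rewrite /= leqnn.
  by rewrite -(inj_eq val_inj) /= ltnS => jm; case: ltngtP jm.
rewrite (eq_bigl (fun j : 'I_n => (j < n)%N)); last by move=> j; rewrite ltn_ord.
by rewrite -(H n) //; congr B; apply/ffunP => j; rewrite !ffunE ltn_ord.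
Qed.

(* The coordinates of g are split off one at a time; summing over all of g at
   every stage costs only the factor #|I|, which cancels at the end. *)
Lemma multilinear_expand B (I : finType) (u : 'I_n -> I -> X) : multilinear B ->
  (0 < #|I|)%N ->
  B [ffun j => \sum_i u j i] =
  \sum_(g : {ffun 'I_n -> I}) B [ffun j => u j (g j)].
Proof.
move=> linB I0.
pose S m := \sum_(g : {ffun 'I_n -> I})
  B [ffun j : 'I_n => if (j < m)%N then u j (g j) else \sum_i u j i].
have SS m : (m < n)%N -> S m = (#|I|)%:R *: S m.+1.
  move=> mn; pose m' := Ordinal mn.
  pose Phi g := B [ffun j : 'I_n => if (j < m.+1)%N then u j (g j) else \sum_i u j i].
  pose up (g : {ffun 'I_n -> I}) i : {ffun 'I_n -> I} :=
    [ffun j => if j == m' then i else g j].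
  have -> : S m = \sum_g \sum_i Phi (up g i).
    apply: eq_bigr => g _.
    set v := [ffun j : 'I_n => if (j < m)%N then _ else _].
    have -> : v = fupd v m' (\sum_i u m' i).
      apply/ffunP => j; rewrite !ffunE; case: eqP => // ->.
      by rewrite /= ltnn.
    rewrite multilinear_sum //; apply: eq_bigr => i _; congr B.
    apply/ffunP => j; rewrite !ffunE; case: eqP => [->|/eqP].
      by rewrite /= leqnn.
    by rewrite -(inj_eq val_inj) /= ltnS => jm; case: ltngtP jm.
  rewrite pair_bigA /=.
  (* The involution [sw] exchanges the new value with the old one at slot [m]. After reindexing,
     every summand is [Phi g], and the free index contributes the factor #|I|. *)
  pose sw (p : {ffun 'I_n -> I} * I) := (up p.1 p.2, p.1 m').
  rewrite (reindex_inj (h := sw)) /=; last first.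
    apply: (can_inj (g := sw)) => -[g i]; rewrite /sw /=; congr (_, _).
      by apply/ffunP => j; rewrite !ffunE; case: eqP => [->|].
    by rewrite ffunE eqxx.
  rewrite -(pair_bigA _ (fun g i => Phi (up (up g i) (g m')))) /= /S scaler_sumr.
  apply: eq_bigr => g _.
  have E i : up (up g i) (g m') = g.
    by apply/ffunP => j; rewrite !ffunE; case: eqP => [->|].
  under eq_bigr do rewrite E.
  by rewrite sumr_const scaler_nat.
have Sm m : (m <= n)%N -> S 0 = (#|I|)%:R ^+ m *: S m.
  elim: m => [_|m IH mn]; first by rewrite expr0 scale1r.
  by rewrite IH 1?ltnW // SS // scalerA exprSr.
have S0 : S 0 = (#|I|)%:R ^+ n *: B [ffun j => \sum_i u j i].
  rewrite /S (eq_bigr (fun=> B [ffun j => \sum_i u j i])); last first.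
    by move=> g _; congr B; apply/ffunP => j; rewrite !ffunE.
  by rewrite sumr_const -scaler_nat card_ffun card_ord natrX.
have Sn : S n = \sum_(g : {ffun 'I_n -> I}) B [ffun j => u j (g j)].
  apply: eq_bigr => g _; congr B; apply/ffunP => j; rewrite !ffunE.
  by rewrite ltn_ord.
have := Sm n (leqnn n); rewrite S0 Sn => /scalerI; apply.
by rewrite expf_neq0 // pnatr_eq0 -lt0n.
Qed.

(** Unnormalized symmetrization: on the diagonal it is n! times [B]. Permutations are injective
    functions, since the expansion of a product of sums runs over all functions. *)
Definition symm B v := \sum_(g : {ffun 'I_n -> 'I_n} | injectiveb g) B [ffun j => v (g j)].

Lemma multilinear_symm B : multilinear B -> multilinear (symm B).
Proof.
move=> linB i v a x y; rewrite /symm scaler_sumr -big_split /=.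
apply: eq_bigr => g /injectiveP ginj.
have E z : [ffun j => fupd v i z (g j)] = fupd [ffun j => v (g j)] (invF ginj i) z.
  apply/ffunP => j; rewrite !ffunE.
  by rewrite -(inj_eq ginj j) f_invF.
by rewrite !E linB.
Qed.

(** For bijective [g] the two products agree and every summand is 1. Otherwise [g] misses some [k],
    and flipping [e k] reverses the sign of each summand, so the sum equals its own opposite. *)
Lemma sum_signs (g : {ffun 'I_n -> 'I_n}) :
  \sum_(e : {ffun 'I_n -> bool}) (\prod_i (-1) ^+ e i * \prod_j (-1) ^+ e (g j)) =
  (if injectiveb g then 2 ^+ n else 0) :> R.
Proof.
case: ifPn => [/injectiveP ginj|ginj].
  rewrite (eq_bigr (fun=> 1)); last first.
    move=> e _; rewrite (reindex_inj ginj) /= -big_split /=.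
    by apply: big1 => i _; rewrite -expr2 sqrr_sign.
  by rewrite sumr_const card_ffun card_bool card_ord natrX.
have [k kg] : exists k, forall j, g j != k.
  apply: contrapT => H; case/negP: ginj; apply/injectiveP.
  have cod k : k \in codom g.
    apply: contrapT => /negP kg; apply: H; exists k => j.
    by apply: contraNneq kg => <-; exact: codom_f.
  have /image_injP ginj : #|codom g| == #|'I_n|.
    by apply/eqP/eq_card => k; rewrite cod.
  by move=> i j; exact: ginj.
pose fl (e : {ffun 'I_n -> bool}) : {ffun 'I_n -> bool} :=
  [ffun i => if i == k then ~~ e i else e i].
have flK : involutive fl.
  by move=> e; apply/ffunP => i; rewrite !ffunE; case: eqP => // _; rewrite negbK.
set T := \sum_e _.
have TN : T = - T.
  rewrite {1}/T (reindex_inj (inv_inj flK)) /= -sumrN; apply: eq_bigr => e _.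
  rewrite (bigD1 k) //= [in RHS](bigD1 k) //= ffunE eqxx signrN !mulNr.
  congr (- (_ * _ * _)).
    by apply: eq_bigr => i /negbTE ik; rewrite ffunE ik.
  by apply: eq_bigr => j _; rewrite ffunE (negbTE (kg j)).
lra.
Qed.

(** Expanding the diagonal values gives a sum over all functions [g], with coefficients that vanish
    unless [g] is a permutation. *)
Lemma polarization B v : (0 < n)%N -> multilinear B ->
  2 ^+ n *: symm B v = \sum_(e : {ffun 'I_n -> bool})
    (\prod_i (-1) ^+ e i : R) *: B [ffun=> \sum_i ((-1) ^+ e i : R) *: v i].
Proof.
move=> n0 linB.
pose c (e : {ffun 'I_n -> bool}) (g : {ffun 'I_n -> 'I_n}) : R :=
  \prod_i (-1) ^+ e i * \prod_j (-1) ^+ e (g j).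
have E (e : {ffun 'I_n -> bool}) :
    (\prod_i (-1) ^+ e i : R) *: B [ffun=> \sum_i ((-1) ^+ e i : R) *: v i] =
    \sum_(g : {ffun 'I_n -> 'I_n}) c e g *: B [ffun j => v (g j)].
  have := multilinear_expand (fun _ i => ((-1) ^+ e i : R) *: v i) linB.
  rewrite card_ord => /(_ n0) ->; rewrite scaler_sumr; apply: eq_bigr => g _.
  by rewrite (multilinear_scale_all (fun j => (-1) ^+ e (g j)) (fun j => v (g j)) linB) scalerA.
rewrite (eq_bigr _ (fun e _ => E e)).
rewrite exchange_big /= /symm scaler_sumr [LHS]big_mkcond /=.
apply: eq_bigr => g _.
by rewrite -scaler_suml sum_signs; case: ifP; rewrite // scale0r.
Qed.

(** Continuity at 0 bounds the diagonal on a ball, polarization carries this bound to the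
    symmetrized form on short vectors, and homogeneity in each slot extends it to all vectors. *)
Lemma symm_bound B : multilinear B -> (0 < n)%N ->
  continuous (fun x => B [ffun=> x]) ->
  exists M : R, 0 <= M /\ forall v, `|symm B v| <= M * \prod_i `|v i|.
Proof.
move=> linB n0 contB; set F := fun x => B _ in contB.
have [d d0 Fd] : exists2 d : R, 0 < d & forall x, `|x| <= d -> `|F x| <= `|F 0| + 1.
  have /cvgr_dist_le/(_ 1 ltr01) := contB 0.
  rewrite near_nbhs => /nbhs_norm0P[d /= d0 H]; exists (d / 2); first by rewrite divr_gt0.
  move=> x xd; have := H x; rewrite /= => Hx.
  rewrite -[F x](subrKC (F 0)) (le_trans (ler_normD _ _)) // lerD2l distrC Hx //.
  by rewrite (le_lt_trans xd) // ltr_pdivrMr // ltr_pMr // ltr1n.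
set K := `|F 0| + 1 in Fd.
have K0 : 0 <= K by rewrite addr_ge0.
(* A signed sum of [n] vectors of norm at most [r] stays in the ball of radius [d]. *)
set r := d / n%:R.
have r0 : 0 < r by rewrite divr_gt0 // ltr0n.
have small v : (forall i, `|v i| <= r) -> `|symm B v| <= K.
  move=> vr; have P2 : (0 : R) < 2 ^+ n by rewrite exprn_gt0.
  rewrite -(ler_pM2l P2) -{1}(gtr0_norm P2) -normrZ polarization //.
  apply: le_trans (ler_norm_sum _ _ _) _.
  have -> : 2 ^+ n * K = \sum_(e : {ffun 'I_n -> bool}) K.
    by rewrite sumr_const card_ffun card_bool card_ord -natrX mulr_natl.
  apply: ler_sum => e _; rewrite normrZ normr_prod big1 ?mul1r; last first.
    by move=> i _; rewrite normrX normrN1 expr1n.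
  apply: Fd; apply: le_trans (ler_norm_sum _ _ _) _.
  have -> : d = \sum_(i < n) r.
    by rewrite sumr_const card_ord /r -[RHS]mulr_natr divfK // pnatr_eq0 -lt0n.
  by apply: ler_sum => i _; rewrite normrZ normrX normrN1 expr1n mul1r.
exists (K / r ^+ n); split; first by rewrite divr_ge0 // exprn_ge0 // ltW.
(* Each [v i] is rescaled to norm [r]. If [v i = 0], division by zero yields 0 and the identity [vE]
   still holds. *)
move=> v; pose c i := `|v i| / r.
pose v' i := (r / `|v i|) *: v i.
have vE i : c i *: v' i = v i.
  rewrite /c /v' scalerA.
  have [->|vi] := eqVneq (v i) 0; first by rewrite scaler0.
  by rewrite mulrA divfK ?gt_eqF // divff ?scale1r // normr_eq0.
have -> : K / r ^+ n * \prod_i `|v i| = \prod_i c i * K.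
  rewrite (eq_bigr (fun i => r * c i)) => [|i _]; last first.
    by rewrite /c mulrC divfK ?gt_eqF.
  rewrite big_split /= prodr_const card_ord mulrA divfK 1?mulrC //.
  by rewrite expf_neq0 // gt_eqF.
have -> : v = [ffun i => c i *: v' i] by apply/ffunP => i; rewrite ffunE vE.
rewrite (multilinear_scale_all _ _ (multilinear_symm linB)) normrZ.
rewrite ger0_norm ?prodr_ge0 // => [|i _]; last by rewrite divr_ge0 // ltW.
rewrite ler_wpM2l // ?prodr_ge0 // => [i _|]; first by rewrite divr_ge0 // ltW.
apply: small => i; rewrite ffunE /v' normrZ normrM normfV normr_id (gtr0_norm r0).
have [->|vi] := eqVneq (v i) 0; first by rewrite normr0 mulr0 ltW.
by rewrite divfK // normr_eq0.
Qed.

End Polarization.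

(** The given n-linear map may be unbounded, as only its diagonal is continuous. Its symmetrization
    is bounded and has the same diagonal up to the factor [N], the number of permutations. *)
Lemma homogeneous_hpoly (R : realType) (X Y : normedModType R) n (F : X -> Y) :
  homogeneous_polynomial n F -> exists M : R, hpoly n M F.
Proof.
move=> [contF [B linB FE]].
case: n => [|n] in B linB FE *.
  exists `|F 0|; exists (fun=> F 0).
    by split => // w; rewrite big_ord0 mulr1.
  by move=> x; rewrite !FE; congr B; apply/ffunP => -[].
have contB : continuous (fun x => B [ffun=> x]).
  by rewrite (_ : (fun x => _) = F) //; apply/funext => x; rewrite FE.
have [M [M0 bd]] := symm_bound linB isT contB.
pose N := #|[pred g : {ffun 'I_n.+1 -> 'I_n.+1} | injectiveb g]|.
have N0 : (0 < N%:R :> R).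
  rewrite ltr0n; apply/card_gt0P; exists [ffun i => i]; rewrite inE.
  by apply/injectiveP => i j; rewrite !ffunE.
have symmF x : symm B [ffun=> x] = N%:R *: F x.
  rewrite FE /symm (eq_bigr (fun=> B [ffun=> x])) ?sumr_const ?scaler_nat //.
  by move=> g _; congr B; apply/ffunP => j; rewrite !ffunE.
exists (N%:R^-1 * M), (fun w => N%:R^-1 *: symm B [ffun i : 'I_n.+1 => w i]); last first.
  move=> x; rewrite (_ : [ffun i => _] = [ffun=> x]) // symmF scalerA.
  by rewrite mulVf ?gt_eqF // scale1r.
split.
- by rewrite mulr_ge0 // invr_ge0 ltW.
- move=> w w' ww'; congr (_ *: symm B _); apply/ffunP => i; rewrite !ffunE.
  exact: ww'.
- move=> i w ni a x y.
  have E z : [ffun j : 'I_n.+1 => upd w i z j] =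
      fupd [ffun j : 'I_n.+1 => w j] (Ordinal ni) z.
    by apply/ffunP => j; rewrite !ffunE.
  by rewrite !E (multilinear_symm linB) scalerDr !scalerA mulrC.
- have Ni0 : 0 <= N%:R^-1 :> R by rewrite invr_ge0 ltW.
  move=> w; rewrite normrZ -mulrA (ger0_norm Ni0) ler_wpM2l //.
  by apply: le_trans (bd _) _; under eq_bigr do rewrite ffunE.
Qed.

(** * Dominated series *)

Section Series.
Set Implicit Arguments.
Unset Strict Implicit.
Unset Printing Implicit Defensive.
Context {R : realType}.

Lemma cvgn_distP (V : normedModType R) (u : nat -> V) (l : V) :
  u @ \oo --> l <->
  forall e : R, 0 < e -> exists K, forall n, (K <= n)%N -> `|u n - l| <= e.
Proof.
split=> [/cvgrPdist_le H e /H[K _ HK]|H].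
  by exists K => n Kn; rewrite distrC; exact: HK.
apply/cvgrPdist_le => e /H[K HK]; exists K => // n /= Kn.
by rewrite distrC; exact: HK.
Qed.

Lemma cvgn_normB_le (V : normedModType R) (u : nat -> V) (l c : V) (M : R) K :
  u @ \oo --> l -> (forall n, (K <= n)%N -> `|u n - c| <= M) -> `|l - c| <= M.
Proof.
move=> /cvgn_distP ul uM; apply/ler_addgt0Pr => e /ul[K' HK'].
have := HK' _ (leq_maxl K' K); have := uM _ (leq_maxr K' K).
set v := u _ => h1 h2; rewrite -(subrKA v) (le_trans (ler_normD _ _)) //.
by rewrite addrC lerD // distrC.
Qed.

Lemma cvgn_norm_le (V : normedModType R) (u : nat -> V) (l : V) (M : R) :
  u @ \oo --> l -> (forall n, `|u n| <= M) -> `|l| <= M.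
Proof.
move=> ul uM; rewrite -[l]subr0; apply: (cvgn_normB_le (K := 0) ul) => n _.
by rewrite subr0.
Qed.

Lemma cvgn_uniq (V : normedModType R) (u : nat -> V) (l l' : V) :
  u @ \oo --> l -> u @ \oo --> l' -> l = l'.
Proof. by move=> ul ul'; apply: cvg_unique ul ul'; exact: norm_hausdorff. Qed.

Lemma cvgn_limn (V : normedModType R) (u : nat -> V) (l : V) :
  u @ \oo --> l -> limn u = l.
Proof. by move=> ul; apply: cvg_lim ul; exact: norm_hausdorff. Qed.

Lemma cvgn_sum (V : normedModType R) (u : nat -> nat -> V) (l : nat -> V) m :
  (forall i, u i @ \oo --> l i) ->
  (fun n => \sum_(0 <= i < m) u i n) @ \oo --> \sum_(0 <= i < m) l i.
Proof.
move=> ul; elim: m => [|m IH].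
  rewrite (_ : (fun n => _) = fun=> 0); first by rewrite big_geq //; exact: cvg_cst.
  by apply/funext => n; rewrite big_geq.
rewrite (_ : (fun n => _) = (fun n => \sum_(0 <= i < m) u i n + u m n)).
  by rewrite big_nat_recr //=; exact: cvgD.
by apply/funext => n; rewrite big_nat_recr.
Qed.

Lemma psum_tail (U : nat -> R) (N : R) : (forall k, 0 <= U k) ->
  (forall n, \sum_(0 <= k < n) U k <= N) ->
  forall e : R, 0 < e -> exists K, forall m n, (K <= m)%N -> (m <= n)%N ->
    \sum_(m <= k < n) U k <= e.
Proof.
move=> U0 UN e e0.
have cU : cvgn (series U).
  apply: nondecreasing_is_cvgn; first by apply: nondecreasing_series => *.
  by exists N => _ [n _ <-]; exact: UN.
have /cvgn_distP/(_ _ (divr_gt0 e0 (ltr0n _ 2)))[K HK] := cU.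
exists K => m n Km mn.
have -> : \sum_(m <= k < n) U k = series U n - series U m.
  by rewrite sub_series_geq.
apply: le_trans (ler_norm _) _.
have := HK _ Km; have := HK _ (leq_trans Km mn).
set l := limn _; rewrite !ler_norml => /andP[? ?] /andP[? ?].
by apply/andP; split; lra.
Qed.

Lemma psum_ge_term (U : nat -> R) (N : R) : (forall k, 0 <= U k) ->
  (forall n, \sum_(0 <= k < n) U k <= N) -> forall k, U k <= N.
Proof.
move=> U0 UN k; apply: le_trans (UN k.+1); rewrite big_nat_recr //= lerDr.
by rewrite sumr_ge0.
Qed.

Lemma series_dominated (V : completeNormedModType R) (u : nat -> V)
    (U : nat -> R) (N : R) :
  (forall k, `|u k| <= U k) -> (forall n, \sum_(0 <= k < n) U k <= N) ->
  series u @ \oo --> limn (series u) /\ `|limn (series u)| <= N.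
Proof.
move=> uU UN; have U0 k : 0 <= U k := le_trans (normr_ge0 _) (uU k).
have c : series u @ \oo --> limn (series u).
  apply: normed_cvg; apply: nondecreasing_is_cvgn.
    by apply: nondecreasing_series => k _ _ /=.
  exists N => _ [n _ <-]; apply: le_trans (UN n).
  by apply: ler_sum => k _; exact: uU.
split => //; apply: (cvgn_norm_le c) => n; apply: le_trans (UN n).
apply: le_trans (ler_norm_sum _ _ _) _; apply: ler_sum => k _; exact: uU.
Qed.

(** Exchange of two summations: the rows from [K0] on contribute at most e / 3 however the columns
    are truncated, and the finitely many other rows converge. *)
Lemma double_series (V : completeNormedModType R) (u : nat -> nat -> V)
    (U : nat -> nat -> R) (S : nat -> R) (N : R) (H : nat -> V) :
  (forall k n, `|u k n| <= U k n) ->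
  (forall k m, \sum_(0 <= n < m) U k n <= S k) ->
  (forall m, \sum_(0 <= k < m) S k <= N) ->
  (forall k, series (u k) @ \oo --> H k) ->
  series (fun n => limn (series (fun k => u k n))) @ \oo --> limn (series H).
Proof.
move=> uU US SN uH.
have U0 k n : 0 <= U k n := le_trans (normr_ge0 _) (uU k n).
have uS k n : `|u k n| <= S k.
  by apply: le_trans (uU k n) _; exact: (psum_ge_term (U0 k) (US k)).
have S0 k : 0 <= S k := le_trans (normr_ge0 _) (uS k 0).
have HS k : `|H k| <= S k.
  apply: (cvgn_norm_le (uH k)) => m; apply: le_trans (US k m).
  by apply: le_trans (ler_norm_sum _ _ _) _; apply: ler_sum => n _; exact: uU.
have [cH _] := series_dominated HS SN.
have cb n := (series_dominated (fun k => uS k n) SN).1.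
apply/cvgn_distP => e e0.
have e3 : 0 < e / 3 by rewrite divr_gt0.
have [K0 HK0] := psum_tail S0 SN e3.
have B : `|limn (series H) - series H K0| <= e / 3.
  apply: (cvgn_normB_le (K := K0) cH) => n Kn; rewrite sub_series_geq //.
  apply: le_trans (ler_norm_sum _ _ _) _; apply: le_trans (HK0 _ _ (leqnn _) Kn).
  by apply: ler_sum => k _; exact: HS.
have /cvgn_distP/(_ _ e3)[m0 Hm0] := cvgn_sum (m := K0) uH.
exists m0 => m mm0; have C := Hm0 _ mm0.
have A : `|series (fun n => limn (series (fun k => u k n))) m -
    \sum_(0 <= k < K0) series (u k) m| <= e / 3.
  apply: (cvgn_normB_le (K := K0) (cvgn_sum (m := m) cb)) => n Kn.
  have -> : \sum_(0 <= i < m) series (fun k => u k i) n =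
      \sum_(0 <= k < n) series (u k) m.
    by rewrite exchange_big.
  rewrite (big_cat_nat (n := K0)) //= addrAC subrr add0r.
  apply: le_trans (ler_norm_sum _ _ _) _; apply: le_trans (HK0 _ _ (leqnn _) Kn).
  apply: ler_sum => k _; apply: le_trans (US k m).
  apply: le_trans (ler_norm_sum _ _ _) _; apply: ler_sum => j _; exact: uU.
rewrite -(subrKA (\sum_(0 <= k < K0) series (u k) m)).
rewrite -[X in _ + X](subrKA (series H K0)).
apply: le_trans (ler_normD _ _) _.
have -> : e = e / 3 + (e / 3 + e / 3) by field.
rewrite lerD // (le_trans (ler_normD _ _)) // lerD //.
by rewrite distrC.
Qed.

End Series.

(** * Infinite sums of homogeneous polynomials of one degree *)

Section HpolyLimit.
Set Implicit Arguments.
Unset Strict Implicit.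
Unset Printing Implicit Defensive.
Context {R : realType} {X : normedModType R} {Y : completeNormedModType R}.

Lemma hpoly_series n (M : nat -> R) (N : R) (F : nat -> X -> Y) :
  (forall k, hpoly n (M k) (F k)) -> (forall K, \sum_(0 <= k < K) M k <= N) ->
  hpoly n N (fun x => limn (series (fun k => F k x))).
Proof.
move=> homF MN.
(* The forms themselves are summed, since the limit must again be the diagonal of a form. *)
have [b Hb] := choice (fun k => let: ex_intro2 b bf Fb := homF k in
  ex_intro (fun b => mform n (M k) b /\ forall x, F k x = b (fun=> x)) b (conj bf Fb)).
have N0 : 0 <= N by have := MN 0; rewrite big_geq.
have cb w := @series_dominated _ _ (fun k => b k w)
  (fun k => M k * \prod_(i < n) `|w i|) (N * \prod_(i < n) `|w i|).
have {}cb w : series (fun k => b k w) @ \oo --> limn (series (fun k => b k w)) /\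
    `|limn (series (fun k => b k w))| <= N * \prod_(i < n) `|w i|.
  apply: cb => [k|m]; first by have [[_ _ _ +] _] := Hb k; exact.
  by rewrite -mulr_suml ler_wpM2r // prodr_ge0.
exists (fun w => limn (series (fun k => b k w))); last first.
  by move=> x; congr (limn (series _)); apply/funext => k; rewrite (Hb k).2.
split => //.
- move=> w w' ww'; congr (limn (series _)); apply/funext => k.
  by have [[_ loc _ _] _] := Hb k; exact: loc.
- move=> i w ni a x y; apply: cvgn_limn.
  have -> : series (fun k => b k (upd w i (a *: x + y))) =
      (fun m => a *: series (fun k => b k (upd w i x)) m +
                series (fun k => b k (upd w i y)) m).
    apply/funext => m; rewrite /series /= scaler_sumr -big_split /=.
    by apply: eq_bigr => k _; have [[_ _ lin _] _] := Hb k; rewrite lin.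
  by apply: cvgD; [apply: cvgZr|]; exact: (cb _).1.
- by move=> w; exact: (cb w).2.
Qed.

End HpolyLimit.

(** * Functions with a majorized power series *)

Section Majorized.
Set Implicit Arguments.
Unset Strict Implicit.
Unset Printing Implicit Defensive.
Context {R : realType} {X : normedModType R}.
Implicit Types (Y : normedModType R) (Z : completeNormedModType R).

Definition majorized Y (a : X) (r N : R) (h : X -> Y) : Prop :=
  exists (F : nat -> X -> Y) (M : nat -> R),
    [/\ forall n, hpoly n (M n) (F n),
        forall n, \sum_(0 <= k < n) M k * r ^+ k <= N &
        forall v, `|v| <= r -> series (fun n => F n v) @ \oo --> h (a + v)].

Lemma majorized_ge0 Y (a : X) (r N : R) (h : X -> Y) : majorized a r N h -> 0 <= N.
Proof. by move=> [F [M [_ /(_ 0) + _]]]; rewrite big_geq. Qed.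

Lemma majorizedW Y (a : X) (r N N' : R) (h : X -> Y) :
  N <= N' -> majorized a r N h -> majorized a r N' h.
Proof.
move=> NN' [F [M [FM MN Fh]]]; exists F, M; split => // n.
exact: le_trans (MN n) NN'.
Qed.

Lemma majorized_ext Y (a : X) (r N : R) (h h' : X -> Y) :
  (forall v, `|v| <= r -> h (a + v) = h' (a + v)) ->
  majorized a r N h -> majorized a r N h'.
Proof.
move=> hh' [F [M [FM MN Fh]]]; exists F, M; split => // v vr.
by rewrite -hh' //; exact: Fh.
Qed.

Lemma majorized_shrink Y (a : X) (r r' N : R) (h : X -> Y) :
  0 <= r' -> r' <= r -> majorized a r N h -> majorized a r' N h.
Proof.
move=> r'0 rr' [F [M [FM MN Fh]]]; exists F, M; split => // [n|v vr].
  apply: le_trans (MN n); apply: ler_sum => k _.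
  by rewrite ler_wpM2l ?(hpoly_ge0 (FM k)) // lerXn2r // nnegrE // (le_trans r'0).
by apply: Fh; exact: le_trans rr'.
Qed.

Lemma majorized_norm Y (a : X) (r N : R) (h : X -> Y) v :
  majorized a r N h -> `|v| <= r -> `|h (a + v)| <= N.
Proof.
move=> [F [M [FM MN Fh]]] vr; apply: (cvgn_norm_le (Fh v vr)) => n.
apply: le_trans (MN n); apply: le_trans (ler_norm_sum _ _ _) _.
apply: ler_sum => k _; apply: le_trans (hpoly_bound _ (FM k)) _.
rewrite ler_wpM2l ?(hpoly_ge0 (FM k)) // lerXn2r // nnegrE //.
exact: le_trans vr.
Qed.

Lemma majorized_cst Y (a : X) (r : R) (y : Y) : majorized a r `|y| (fun=> y).
Proof.
exists (fun n => if n == 0 then fun=> y else fun=> 0),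
  (fun n => if n == 0 then `|y| else 0); split.
- by case=> [|n] /=; [exact: hpoly_cst|exact: hpoly0].
- case=> [|n]; first by rewrite big_geq.
  rewrite big_nat_recl //= expr0 mulr1 big1_seq ?addr0 // => k _.
  by rewrite mul0r.
- move=> v _; apply/cvgn_distP => e e0; exists 1 => -[//|n] _.
  rewrite /series /= big_nat_recl //= big1_seq ?addr0 ?subrr ?normr0 ?ltW //.
Qed.

Lemma majorizedD Y (a : X) (r N N' : R) (h h' : X -> Y) :
  majorized a r N h -> majorized a r N' h' ->
  majorized a r (N + N') (fun x => h x + h' x).
Proof.
move=> [F [M [FM MN Fh]]] [F' [M' [FM' MN' Fh']]].
exists (fun n x => F n x + F' n x), (fun n => M n + M' n); split.
- by move=> n; exact: hpolyD.
- move=> n; under eq_bigr do rewrite mulrDl.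
  by rewrite big_split lerD.
- move=> v vr; rewrite (_ : series _ =
    (fun n => series (fun n => F n v) n + series (fun n => F' n v) n)).
    by apply: cvgD; [exact: Fh|exact: Fh'].
  by apply/funext => n; rewrite /series /= big_split.
Qed.

Lemma majorized_sum Y (a : X) (r : R) m (N : nat -> R) (h : nat -> X -> Y) :
  (forall i, (i < m)%N -> majorized a r (N i) (h i)) ->
  majorized a r (\sum_(0 <= i < m) N i) (fun x => \sum_(0 <= i < m) h i x).
Proof.
elim: m => [|m IH] H.
  rewrite big_geq // (_ : (fun x => _) = fun=> 0).
    by rewrite -(@normr0 _ Y); exact: majorized_cst.
  by apply/funext => x; rewrite big_geq.
rewrite big_nat_recr //= (_ : (fun x => _) = (fun x => \sum_(0 <= i < m) h i x + h m x)).
  by apply: majorizedD; [apply: IH => i im; apply: H; exact: ltnW|exact: H].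
by apply/funext => x; rewrite big_nat_recr.
Qed.

(** The parts of equal degree are summed over [k]; they are summable because
    [M k n * r ^+ n <= S k]. The exchange of summations then identifies the resulting power series
    with the sum of the functions. *)
Lemma majorized_series Z (a : X) (r N : R) (S : nat -> R) (h : nat -> X -> Z) :
  0 < r ->
  (forall k, majorized a r (S k) (h k)) ->
  (forall n, \sum_(0 <= k < n) S k <= N) ->
  majorized a r N (fun x => limn (series (fun k => h k x))).
Proof.
move=> r0 hS SN.
have [F HF] := choice hS.
have [M HM] := choice HF.
have S0 k : 0 <= S k := majorized_ge0 (hS k).
have M0 k n : 0 <= M k n by have [FM _ _] := HM k; exact: hpoly_ge0 (FM n).
have Mr0 k n : 0 <= M k n * r ^+ n by rewrite mulr_ge0 // exprn_ge0 // ltW.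
have MS k n : M k n * r ^+ n <= S k.
  have [_ MSk _] := HM k.
  exact: (@psum_ge_term _ (fun n => M k n * r ^+ n) (S k) (Mr0 k) MSk).
have sumM n K : \sum_(0 <= k < K) M k n <= N / r ^+ n.
  rewrite ler_pdivlMr ?exprn_gt0 // mulr_suml; apply: le_trans (SN K).
  by apply: ler_sum => k _; exact: MS.
exists (fun n x => limn (series (fun k => F k n x))),
  (fun n => limn (series (fun k => M k n))).
have Mle k n : `|M k n : R^o| <= M k n by rewrite ger0_norm.
have cM n := (@series_dominated R R^o _ _ _ (fun k => Mle k n) (sumM n)).1.
split.
- move=> n; apply: hpoly_series => [k|K]; first by have [FM _ _] := HM k; exact: FM.
  apply: nondecreasing_cvgn_le; last exact: cM.
  by apply: nondecreasing_series.
- move=> m.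
  (* The bound on the sum of the limits comes from finite truncations, where the two sums may be
     exchanged. *)
  have : (fun K => \sum_(0 <= n < m) (series (fun k => M k n) K) * r ^+ n) @ \oo -->
      \sum_(0 <= n < m) limn (series (fun k => M k n)) * r ^+ n.
    by apply: (@cvgn_sum R R^o (fun n K => series (fun k => M k n) K * r ^+ n)) => n; apply: cvgMl; exact: cM.
  move=> cv; apply: le_trans (ler_norm _) _.
  apply: (cvgn_norm_le (V := R^o) cv) => K.
  rewrite ger0_norm; last first.
    apply: sumr_ge0 => n _; apply: mulr_ge0; last by rewrite exprn_ge0 // ltW.
    by rewrite /series /= sumr_ge0.
  apply: le_trans (SN K); under eq_bigr do rewrite mulr_suml.
  rewrite exchange_big /=; apply: ler_sum => k _.
  by have [_ MSk _] := HM k; exact: MSk.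
- move=> v vr; apply: (double_series (U := fun k n => M k n * r ^+ n) (S := S) (N := N)) => //.
  + move=> k n; have [FM _ _] := HM k; apply: le_trans (hpoly_bound _ (FM n)) _.
    by rewrite ler_wpM2l // lerXn2r // nnegrE // ltW.
  + by move=> k m; have [_ MSk _] := HM k; exact: MSk.
  + by move=> k; have [_ _ Fh] := HM k; exact: Fh.
Qed.

Lemma sum_shift (V : nmodType) (c : nat -> V) k n :
  \sum_(0 <= i < n + k) (if (i < k)%N then 0 else c (i - k)%N) = \sum_(0 <= j < n) c j.
Proof.
rewrite (big_cat_nat (n := k)) //= ?leq_addl // big1_seq ?add0r; last first.
  by move=> i /=; rewrite mem_index_iota => /andP[_ ->].
rewrite -{1}[k]add0n big_addn addnK; apply: eq_bigr => j _.
by rewrite ltnNge leq_addl /= addnK.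
Qed.

(** Multiplication by a part of degree [k] shifts all degrees by [k]. *)
Lemma majorized_monomial Y (a : X) (r M N : R) k (G : X -> R^o) (h : X -> Y) :
  0 <= r -> hpoly k M G -> majorized a r N h ->
  majorized a r (M * r ^+ k * N) (fun x => (G (x - a) : R) *: h x).
Proof.
move=> r0 GM [F [M' [FM MN Fh]]].
exists (fun n x => if (n < k)%N then 0 else (G x : R) *: F (n - k)%N x),
  (fun n => if (n < k)%N then 0 else M * M' (n - k)%N); split.
- move=> n; case: ltnP => [_|kn]; first exact: hpoly0.
  by have := hpolyM GM (FM (n - k)%N); rewrite subnKC.
- move=> n.
  pose U i := (if (i < k)%N then 0 else M * M' (i - k)%N) * r ^+ i.
  have U0 i : 0 <= U i.
    rewrite /U; case: ifP => _; first by rewrite mul0r.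
    by rewrite !mulr_ge0 ?exprn_ge0 ?(hpoly_ge0 GM) ?(hpoly_ge0 (FM _)).
  apply: (@le_trans _ _ (\sum_(0 <= i < n + k) U i)).
    by rewrite [X in _ <= X](big_cat_nat (n := n)) ?leq_addr //= lerDl sumr_ge0.
  rewrite (eq_bigr (fun i => if (i < k)%N then 0 else
      (M * r ^+ k) * (M' (i - k)%N * r ^+ (i - k)))); last first.
    move=> i _; rewrite /U; case: ltnP => [|ki]; first by rewrite mul0r.
    have -> : r ^+ i = r ^+ (i - k) * r ^+ k by rewrite -exprD subnK.
    by ring.
  rewrite (sum_shift (fun j => (M * r ^+ k) * (M' j * r ^+ j))) -mulr_sumr.
  by rewrite ler_wpM2l // mulr_ge0 ?exprn_ge0 ?(hpoly_ge0 GM).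
- move=> v vr; rewrite addrAC subrr add0r -(cvg_shiftn k).
  have -> : [sequence series (fun n => if (n < k)%N then 0 else
      (G v : R) *: F (n - k)%N v) (n + k)%N]_n =
      (fun n => (G v : R) *: series (fun n => F n v) n).
    apply/funext => n; rewrite /series /= (sum_shift (fun j => (G v : R) *: F j v)).
    by rewrite scaler_sumr.
  by apply: cvgZr; exact: Fh.
Qed.

(** Instead of forming a Cauchy product, [h] is multiplied by one homogeneous part of [g] at a time
    and the results are summed as a series of majorized functions. *)
Lemma majorizedM Z (a : X) (r N N' : R) (g : X -> R^o) (h : X -> Z) :
  0 < r -> majorized a r N g -> majorized a r N' h ->
  majorized a r (N * N') (fun x => (g x : R) *: h x).
Proof.
move=> r0 [F [M [FM MN Fg]]] hN'.
have N'0 := majorized_ge0 hN'.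
have := @majorized_series Z a r (N * N') (fun k => M k * r ^+ k * N')
  (fun k x => (F k (x - a) : R) *: h x) r0.
have H1 k := majorized_monomial (ltW r0) (FM k) hN'.
have H2 n : \sum_(0 <= k < n) M k * r ^+ k * N' <= N * N'.
  by rewrite -mulr_suml ler_wpM2r.
move=> /(_ H1 H2); apply: majorized_ext => v vr; apply: cvgn_limn.
rewrite (_ : series _ = (fun n => (series (fun n => F n v) n : R) *: h (a + v))).
  by apply: cvgZl; exact: Fg.
by apply/funext => n; rewrite /series /= scaler_suml; apply: eq_bigr => k _; rewrite addrAC subrr add0r.
Qed.

Lemma majorizedX (a : X) (r N : R) (g : X -> R^o) k :
  0 < r -> majorized a r N g -> majorized a r (N ^+ k) (fun x => (g x : R) ^+ k : R^o).
Proof.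
move=> r0 gN; elim: k => [|k IH].
  have -> : N ^+ 0 = `|1 : R^o| by rewrite expr0 normr1.
  exact: (@majorized_cst R^o).
have := @majorizedM R^o a r N (N ^+ k) g _ r0 gN IH.
rewrite -exprS; apply: majorized_ext => v _.
by rewrite exprS.
Qed.

Lemma majorized_power_series (a : X) (r N K : R) (g : X -> R^o) (c : nat -> R) :
  0 < r -> majorized a r N g ->
  (forall n, \sum_(0 <= k < n) `|c k| * N ^+ k <= K) ->
  majorized a r K (fun x => limn (series (fun k => c k * (g x : R) ^+ k : R^o))).
Proof.
move=> r0 gN cK.
apply: (@majorized_series R^o a r K (fun k => `|c k| * N ^+ k)
  (fun k x => c k * (g x : R) ^+ k : R^o)) => // k.
exact: (majorizedM (Z := R^o) r0 (majorized_cst a r (c k : R^o)) (majorizedX k r0 gN)).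
Qed.

(** The coefficients of the exponential are positive, so its series at [N] bounds the norm of the
    composite. *)
Lemma majorized_exp (a : X) (r N : R) (g : X -> R^o) :
  0 < r -> majorized a r N g -> majorized a r (expR N) (fun x => expR (g x) : R^o).
Proof.
move=> r0 gN; have N0 := majorized_ge0 gN.
have expE (x : R) : series (exp_coeff x) = series (fun k => k`!%:R^-1 * x ^+ k).
  by congr series; apply/funext => k; rewrite /exp_coeff /= mulrC.
have H n : \sum_(0 <= k < n) `|k`!%:R^-1 : R| * N ^+ k <= expR N.
  under eq_bigr do rewrite ger0_norm ?invr_ge0 //.
  rewrite /expR expE; apply: nondecreasing_cvgn_le.
    by apply: nondecreasing_series => k _ _; rewrite mulr_ge0 ?exprn_ge0 // invr_ge0.
  by rewrite -expE; exact: is_cvg_series_exp_coeff.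
apply: majorized_ext (majorized_power_series r0 gN H) => v _.
by rewrite /expR expE.
Qed.

(** Without a constant term, every term gains a factor t^k with k >= 1, hence at least [t], when the
    radius shrinks by [t]. *)
Lemma majorized_vanish Y (a : X) (r N t : R) (h : X -> Y) :
  0 <= r -> 0 <= t -> t <= 1 -> majorized a r N h -> h a = 0 ->
  majorized a (t * r) (t * N) h.
Proof.
move=> r0 t0 t1 [F [M [FM MN Fh]]] ha.
have tr0 : 0 <= t * r by rewrite mulr_ge0.
have F0 x : F 0 x = 0.
  rewrite (hpoly_0_cst x (FM 0)); apply: (@cvgn_uniq _ _ (series (fun n => F n 0))).
    apply/cvgn_distP => e e0; exists 1 => -[//|n] _.
    rewrite /series /= big_nat_recl //= big1_seq ?addr0 ?subrr ?normr0 ?ltW //.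
    by move=> k _; exact: hpoly_0 (FM k.+1).
  by rewrite -[in X in _ --> X]ha -[a in h a]addr0; apply: Fh; rewrite normr0.
exists F, (fun n => if n == 0 then 0 else M n); split.
- case=> [|n] //=; rewrite (_ : F 0 = fun=> 0); first exact: hpoly0.
  exact/funext.
- case=> [|n]; first by rewrite big_geq // mulr_ge0 // (le_trans _ (MN 0)) // big_geq.
  rewrite big_nat_recl //= mul0r add0r.
  apply: (@le_trans _ _ (t * \sum_(0 <= k < n.+1) M k * r ^+ k)); last first.
    by rewrite ler_wpM2l.
  rewrite [X in _ <= t * X]big_nat_recl //= mulrDr mulr_sumr ler_wpDl //.
    by rewrite mulr_ge0 // mulr_ge0 ?(hpoly_ge0 (FM 0)).
  apply: ler_sum => k _; rewrite mulrCA ler_wpM2l ?(hpoly_ge0 (FM _)) //.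
  by rewrite exprMn ler_wpM2r ?exprn_ge0 // exprS ler_piMr // exprn_ile1.
- by move=> v vr; apply: Fh; rewrite (le_trans vr) // ler_piMl.
Qed.

(** Geometric series in u = 1 - g / g(a). As [u] vanishes at [a], shrinking the radius brings its
    norm down to 1/2. *)
Lemma majorized_inv (a : X) (r N : R) (g : X -> R^o) :
  0 < r -> majorized a r N g -> (g a : R) != 0 ->
  exists r' N' : R, [/\ 0 < r', r' <= r & majorized a r' N' (fun x => (g x : R)^-1 : R^o)].
Proof.
move=> r0 gN ga; have N0 := majorized_ge0 gN.
pose c : R := (g a)^-1.
pose u : X -> R^o := fun x => 1 - c * g x.
have uN : majorized a r (1 + `|c| * N) u.
  have := majorizedD (majorized_cst a r (1 : R^o))
    (majorizedM (Z := R^o) r0 (majorized_cst a r (- c : R^o)) gN).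
  rewrite normr1 normrN; apply: majorized_ext => v _.
  by rewrite /u /GRing.scale /= mulNr.
set K := 1 + `|c| * N in uN.
have K1 : 1 <= K by rewrite lerDl mulr_ge0.
have K0 : 0 < K by apply: lt_le_trans K1.
pose t := (2 * K)^-1.
have t0 : 0 < t by rewrite invr_gt0 mulr_gt0.
have t1 : t <= 1 by rewrite invf_le1 ?mulr_gt0 //; lra.
have ua : u a = 0 by rewrite /u /c mulVf // subrr.
have uh := majorized_vanish (ltW r0) (ltW t0) t1 uN ua.
have tK : t * K = 2^-1 by rewrite /t invfM mulfVK // gt_eqF.
rewrite tK in uh.
have tr0 : 0 < t * r by rewrite mulr_gt0.
have geo n : \sum_(0 <= k < n) `|1 : R| * 2^-1 ^+ k <= 2.
  have -> : \sum_(0 <= k < n) `|1 : R| * 2^-1 ^+ k = 2 - 2 * 2^-1 ^+ n.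
    elim: n => [|n IH]; first by rewrite big_geq // expr0 mulr1 subrr.
    by rewrite big_nat_recr //= IH normr1 exprS; lra.
  by rewrite gerBl mulr_ge0 // exprn_ge0.
have := majorizedM (Z := R^o) tr0 (majorized_cst a (t * r) (c : R^o))
  (majorized_power_series tr0 uh geo).
move=> H; exists (t * r); eexists; split => //; first by rewrite ler_piMl // ltW.
apply: majorized_ext H => v vr.
have u1 : `|u (a + v)| <= 2^-1 by exact: (majorized_norm uh vr).
have -> : limn (series (fun k => 1 * (u (a + v) : R) ^+ k : R^o)) = (1 - u (a + v))^-1.
  apply: cvgn_limn; rewrite -[X in _ --> X]mul1r.
  by apply: cvg_geometric_series; rewrite (le_lt_trans u1) // invf_lt1 // ltr1n.
rewrite /u subKr /GRing.scale /=.
by rewrite invfM mulrA divff ?mul1r // invr_neq0.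
Qed.

(** The constant term cancels, and each of the [n] remaining terms carries a power of [r] at most
    [r]. This linear factor lets increments be made small by the choice of radius. *)
Lemma majorized_sub_cst n (M : R) (F : X -> R^o) (a : X) (r : R) :
  0 <= r -> r <= 1 -> hpoly n M F ->
  majorized a r (r * (n%:R * (M * (1 + `|a|) ^+ n))) (fun x => F x - F a).
Proof.
move=> r0 r1 homF; have [G [homG FE]] := hpoly_expand a homF.
set K := M * _ in homG *.
have K0 : 0 <= K := hpoly_ge0 (homG 0).
have G0 v : G 0 v = F a.
  rewrite (hpoly_0_cst v (homG 0)) -[a in F a]addr0 FE big_nat_recl //=.
  rewrite big1_seq ?addr0 // => k _; exact: hpoly_0 (homG k.+1).
have := majorized_sum (m := n) (fun k _ =>
  majorized_monomial r0 (homG k.+1) (majorized_cst a r (1 : R^o))).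
move=> H; apply: (@majorizedW _ _ _ (\sum_(0 <= k < n) K * r ^+ k.+1 * `|1 : R^o|)).
  rewrite mulrCA mulr_natl -[n in X in _ <= X]subn0 -sumr_const_nat.
  apply: ler_sum => k _; rewrite normr1 mulr1 mulrC ler_wpM2r //.
  by rewrite exprS ler_piMr // exprn_ile1.
apply: majorized_ext H => v _.
rewrite FE big_nat_recl //= G0 [in RHS]addrC addKr; apply: eq_bigr => k _.
by rewrite addrAC subrr add0r /GRing.scale /= mulr1.
Qed.

(** Weierstrass test: the tails of the sums of [M k * r ^+ k] bound the tails of the series
    uniformly on the ball. *)
Lemma majorized_analytic Y (G : set X) (h : X -> Y) : open G ->
  (forall a, G a -> exists r N : R, 0 < r /\ majorized a r N h) -> analytic_on G h.
Proof.
move=> oG H a Ga; have [r [N [r0 [F [M [FM MN Fh]]]]]] := H a Ga.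
have M0 n : 0 <= M n := hpoly_ge0 (FM n).
exists (G `&` [set x | `|x - a| <= r]); split.
- apply: filterI; first exact: open_nbhs_nbhs.
  apply/nbhs_normP; exists r => // x /=; rewrite distrC; exact: ltW.
- by move=> x [].
exists F; split; first by move=> n; exact: hpoly_homogeneous (FM n).
move=> P /uniform_nbhs [E [entE EP]].
move: entE; rewrite -entourage_from_ballE => -[e /= e0 eE].
have Mr0 k : 0 <= M k * r ^+ k by rewrite mulr_ge0 // exprn_ge0 // ltW.
have [K HK] := psum_tail Mr0 MN (divr_gt0 e0 (ltr0n R 2)).
exists K => // n /= Kn; apply: EP => x [_ xr]; apply: eE => /=.
rewrite -ball_normE /=.
have cv := Fh _ xr; rewrite subrKC in cv.
apply: (@le_lt_trans _ _ (e / 2)); last by rewrite ltr_pdivrMr // ltr_pMr // ltr1n.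
apply: (cvgn_normB_le (K := n) cv) => m nm; rewrite sub_series_geq //.
apply: le_trans (HK _ _ Kn nm); apply: le_trans (ler_norm_sum _ _ _) _.
apply: ler_sum => k _; apply: le_trans (hpoly_bound _ (FM k)) _.
by rewrite ler_wpM2l // lerXn2r // nnegrE // ltW.
Qed.

End Majorized.

(** * Gaussian bumps *)

Section Nets.
Set Implicit Arguments.
Unset Strict Implicit.
Unset Printing Implicit Defensive.
Context {R : realType}.

Lemma interval_net (l u s : R) : 0 < s -> exists (m : nat) (y : nat -> R),
  (forall k, (k < m)%N -> l <= y k <= u) /\
  forall z, l <= z <= u -> exists2 k, (k < m)%N & (z - y k) ^+ 2 <= s.
Proof.
move=> s0; have [ul|lu] := ltP u l.
  exists 0, (fun=> 0); split => // z /andP[lz zu].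
  by have := lt_le_trans ul (le_trans lz zu); rewrite ltxx.
pose h := Num.sqrt s.
have h0 : 0 < h by rewrite sqrtr_gt0.
have hs : h ^+ 2 = s by rewrite sqr_sqrtr // ltW.
(* Capping at [u] keeps the points in the interval; it leaves the chosen point unchanged, because
   that point is at most [z]. *)
exists (Num.truncn ((u - l) / h)).+1, (fun k => Num.min (l + k%:R * h) u); split.
  move=> k _; rewrite le_min lu ge_min lexx orbT !andbT lerDl mulr_ge0 //.
  exact: ltW.
move=> z /andP[lz zu].
have zl : 0 <= (z - l) / h by rewrite divr_ge0 ?subr_ge0 // ltW.
have /andP[] := truncn_itv zl.
set k := Num.truncn _; rewrite ler_pdivlMr // ltr_pdivrMr // => k1 k2.
exists k; first by rewrite ltnS le_truncn // ler_pM2r ?invr_gt0 // lerB.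
rewrite min_l; last by apply: le_trans zu; rewrite -lerBrDl.
have ge0 : 0 <= z - (l + k%:R * h) by lra.
have leh : z - (l + k%:R * h) <= h by rewrite -natr1 mulrDl in k2; lra.
by rewrite -hs lerXn2r // nnegrE // ltW.
Qed.

Lemma box_net n (l u : nat -> R) (s : R) : 0 < s -> exists (m : nat) (y : nat -> nat -> R),
  (forall k j, (k < m)%N -> (j < n)%N -> l j <= y k j <= u j) /\
  forall z : nat -> R, (forall j, (j < n)%N -> l j <= z j <= u j) ->
    exists2 k, (k < m)%N & \sum_(0 <= j < n) (z j - y k j) ^+ 2 <= s.
Proof.
elim: n s => [|n IH] s s0.
  exists 1, (fun _ _ => 0); split => // z _; exists 0 => //.
  by rewrite big_geq // ltW.
have s2 : 0 < s / 2 by rewrite divr_gt0.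
have [m [y [ylu ynet]]] := IH _ s2.
have [K [c [clu cnet]]] := interval_net (l n) (u n) s2.
(* A pair of indices is coded as [j * K + k] and decoded by quotient and remainder. *)
exists (m * K)%N, (fun k j => if j == n then c (k %% K)%N else y (k %/ K)%N j); split.
  move=> k j kmK jn; have K0 : (0 < K)%N by case: K kmK {clu cnet} => //; rewrite muln0.
  case: eqP => [->|/eqP jn']; first by rewrite clu // ltn_mod.
  by apply: ylu; [rewrite ltn_divLR|lia].
move=> z zlu.
have [j jm jz] := ynet z (fun j jn => zlu j (leqW jn)).
have [k kK kz] := cnet (z n) (zlu n (leqnn _)).
have K0 : (0 < K)%N by case: K kK {clu cnet}.
exists (j * K + k)%N.
  apply: (@leq_trans (j.+1 * K)); last by rewrite leq_mul2r jm orbT.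
  by rewrite mulSn addnC ltn_add2r.
rewrite big_nat_recr //= eqxx modnMDl modn_small // divnMDl // divn_small // addn0.
rewrite [s](_ : _ = s / 2 + s / 2); last by field.
apply: lerD => //; apply: le_trans jz; rewrite big_nat_cond [leRHS]big_nat_cond.
by apply: ler_sum => i /andP[/andP[_ /ltn_eqF ->]].
Qed.

Lemma expR_large (C e : R) : 0 <= C -> 0 < e -> exists K : R, 0 <= K /\
  forall x, K <= x -> C * expR (- x) <= e /\ C <= expR x.
Proof.
(* Both estimates follow from [1 + x <= expR x]: the summand [C / e] serves the first, [C] the
   second. *)
move=> C0 e0; exists (C / e + C); split; first by rewrite addr_ge0 // divr_ge0 // ltW.
move=> x Kx; have x1 : 1 + x <= expR x := expR_ge1Dx x.
have Ce : 0 <= C / e by rewrite divr_ge0 // ltW.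
split; last by lra.
rewrite expRN ler_pdivrMr ?expR_gt0 // mulrC -ler_pdivrMr //.
by apply: le_trans x1; lra.
Qed.

Lemma psum_bounded (u : nat -> R) n0 :
  (forall n, (n0 <= n)%N -> u n <= 2^-1 ^+ n) ->
  exists N, forall m, \sum_(0 <= n < m) u n <= N.
Proof.
(* [v] is a nonnegative majorant of [u], so its sums may be extended, and it equals the geometric
   term from [n0] on. *)
move=> un0; pose v n := Num.max (u n) (2^-1 ^+ n).
have v0 n : 0 <= v n by rewrite le_max exprn_ge0 ?orbT.
have half m : \sum_(0 <= n < m) (2^-1 : R) ^+ n = 2 - 2 * 2^-1 ^+ m.
  elim: m => [|m IH]; first by rewrite big_geq // expr0 mulr1 subrr.
  by rewrite big_nat_recr //= IH exprS; lra.
exists (\sum_(0 <= n < n0) v n + 2) => m.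
apply: (@le_trans _ _ (\sum_(0 <= n < n0 + m) v n)).
  rewrite [leRHS](big_cat_nat (n := m)) ?leq_addl //= ler_wpDr ?sumr_ge0 //.
  by apply: ler_sum => n _; rewrite le_max lexx.
rewrite (big_cat_nat (n := n0)) ?leq_addr //= lerD2l.
apply: (@le_trans _ _ (\sum_(n0 <= n < n0 + m) (2^-1) ^+ n)).
  rewrite big_nat_cond [leRHS]big_nat_cond.
  by apply: ler_sum => n /andP[/andP[nn _] _]; rewrite /v max_r // un0.
apply: (@le_trans _ _ (\sum_(0 <= n < n0 + m) (2^-1) ^+ n)).
  by rewrite [leRHS](big_cat_nat (n := n0)) ?leq_addr //= lerDr sumr_ge0.
by rewrite half gerBl mulr_ge0 // exprn_ge0.
Qed.

End Nets.

(** * Sums of Gaussians centred at finite nets *)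

Section Bumps.
Set Implicit Arguments.
Unset Strict Implicit.
Unset Printing Implicit Defensive.
Context {R : realType} {X : normedModType R}.

(* Recentring at x0 leaves only the increments of the q j, and by
   2 a b <= 2 a^2 + b^2 / 2 half of the distance D x0 absorbs the cross terms;
   the estimate does not depend on the centre p nor on the number of terms. *)
Lemma majorized_gauss (q : nat -> X -> R^o) (p : nat -> R) n (x0 : X)
    (r e K s : R) (N : nat -> R) (D := fun x => \sum_(0 <= j < n) (q j x - p j : R) ^+ 2) :
  0 < r -> 0 <= K ->
  (forall j, majorized x0 r (N j) (fun x => q j x - q j x0)) ->
  \sum_(0 <= j < n) N j ^+ 2 <= e ->
  majorized x0 r (expR (K * (s + 3 * e - D x0 / 2)))
    (fun x => expR (K * (s - D x)) : R^o).
Proof.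
move=> r0 K0 qN Ne.
pose g j x : R^o := q j x - q j x0.
pose b j : R := q j x0 - p j.
have Db : D x0 = \sum_(0 <= j < n) b j ^+ 2 by [].
have H1 j : majorized x0 r (N j ^+ 2 + `|2 * b j| * N j)
    (fun x => (g j x : R) ^+ 2 + (2 * b j) * (g j x : R) : R^o).
  apply: (@majorizedD _ _ R^o).
    exact: majorizedX r0 (qN j).
  exact: (majorizedM (Z := R^o) r0 (majorized_cst x0 r (2 * b j : R^o)) (qN j)).
have H2 := majorizedM (Z := R^o) r0 (majorized_cst x0 r (- K : R^o))
  (majorized_sum (m := n) (fun j _ => H1 j)).
have H3 := majorizedM (Z := R^o) r0
  (majorized_cst x0 r (expR (K * (s - D x0)) : R^o)) (majorized_exp r0 H2).
apply: (@majorizedW _ _ _ _ _ (`|expR (K * (s - D x0)) : R^o| *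
   expR (`|- K : R^o| * \sum_(0 <= i < n) (N i ^+ 2 + `|2 * b i| * N i)))).
  rewrite ger0_norm ?expR_ge0 // -expRD ler_expR normrN ger0_norm // -mulrDr.
  rewrite ler_wpM2l //.
  suff : \sum_(0 <= i < n) (N i ^+ 2 + `|2 * b i| * N i) <= 3 * e + D x0 / 2 by lra.
  apply: (@le_trans _ _ (\sum_(0 <= i < n) (3 * N i ^+ 2 + b i ^+ 2 / 2))).
    apply: ler_sum => i _; rewrite normrM ger0_norm //.
    have -> : b i ^+ 2 = `|b i| ^+ 2 by rewrite real_normK // num_real.
    have := sqr_ge0 (2 * N i - `|b i|); nra.
  by rewrite big_split /= -mulr_sumr -mulr_suml -Db lerD2r ler_pM2l.
apply: majorized_ext H3 => v _.
rewrite /GRing.scale /= -expRD; congr expR; rewrite mulNr -mulrBr; congr (_ * _).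
rewrite -addrA -opprD; congr (_ - _); rewrite /D -big_split /=; apply: eq_bigr => j _.
by rewrite /g /b; ring.
Qed.

(* psi n is a finite sum of Gaussians whose centres form a net of the box
   {y | t j <= y j for j < n, y n <= t n}; kappa n is chosen so large that psi n
   dominates the weights on the layer {q n < t n, t j <= q j for j < n}, is tiny on
   {2 t n <= q n}, and is summable near every point of the union of the {q j < t j}. *)
Lemma analytic_bumps (q : nat -> X -> R^o) (t w : nat -> R) (beta : R) :
  (forall n x, 0 <= q n x :> R) -> (forall n, 0 < t n) -> (forall n, 0 <= w n) ->
  0 < beta ->
  (forall x0 (e : R), 0 < e -> exists (r : R) (N : nat -> R),
    [/\ 0 < r, forall n, majorized x0 r (N n) (fun x => q n x - q n x0) &
        forall m, \sum_(0 <= n < m) N n ^+ 2 <= e]) ->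
  (forall n j, exists C : R, forall x, q n x < t n :> R -> q j x <= C :> R) ->
  exists psi : nat -> X -> R^o,
  [/\ forall n x, 0 <= psi n x :> R,
      forall n x, q n x < t n :> R -> (forall j, (j < n)%N -> t j <= q j x :> R) ->
        1 + w n <= psi n x :> R,
      forall n x, 2 * t n <= q n x :> R ->
        (psi n x : R) * (1 + w n) <= beta * 2^-1 ^+ n.+1 &
      forall x0 j, q j x0 < t j :> R -> exists (r : R) (B : nat -> R) (N : R),
        [/\ 0 < r, forall n, majorized x0 r (B n) (psi n) &
            forall m, \sum_(0 <= n < m) B n * (1 + w n) <= N]].
Proof.
move=> q0 t0 w0 beta0 qW qB.
(* The first bound gives [D >= 2 * s n] wherever [q n >= 2 * t n]; the second makes [s n] tend to 0,
   as the decay near a given point requires. *)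
pose s n : R := Num.min (t n ^+ 2 / 2) n.+1%:R^-1.
have s0 n : 0 < s n by rewrite lt_min invr_gt0 ltr0n divr_gt0 // exprn_gt0.
have Hm n : exists (m : nat) (p : nat -> nat -> R),
    (forall k, (k < m)%N -> p k n <= t n /\ forall j, (j < n)%N -> t j <= p k j) /\
    forall x, q n x < t n :> R -> (forall j, (j < n)%N -> t j <= q j x :> R) ->
      exists2 k, (k < m)%N & \sum_(0 <= j < n.+1) (q j x - p k j : R) ^+ 2 <= s n / 2.
  have [C HC] := choice (qB n).
  (* The box is compact: coordinate [n] lies between 0 and [t n], and coordinate [j] below [n]
     between [t j] and its bound [C j] on {q n < t n}. *)
  have [m [p [pin pnet]]] := box_net n.+1 (fun j => if j == n then 0 else t j)
    (fun j => if j == n then t n else C j) (divr_gt0 (s0 n) (ltr0n R 2)).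
  exists m, p; split.
    move=> k km; split => [|j jn].
      by have := pin k n km (ltnSn n); rewrite eqxx => /andP[].
    by have := pin k j km (leqW jn); rewrite ltn_eqF // => /andP[].
  move=> x qnx qjx; apply: (pnet (fun j => q j x)) => j.
  rewrite ltnS leq_eqVlt; case: eqP => [-> _|_ /= jn].
    by rewrite q0 ltW.
  by rewrite qjx //= HC.
have [m {}Hm] := choice Hm; have [p Hp] := choice Hm.
pose D n k x : R := \sum_(0 <= j < n.+1) (q j x - p n k j : R) ^+ 2.
pose c n : R := (m n)%:R * (1 + w n).
have c0 n : 0 <= c n by rewrite mulr_ge0 // addr_ge0.
have w1 n : 0 <= 1 + w n by rewrite addr_ge0.
have half0 n : 0 < (2^-1 : R) ^+ n by rewrite exprn_gt0 // invr_gt0.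
have [Kb HKb] := choice (fun n => expR_large (c0 n) (mulr_gt0 beta0 (half0 n.+1))).
have [Ka HKa] := choice (fun n => expR_large (w1 n) (@ltr01 R)).
have [Kc HKc] := choice (fun n => expR_large (c0 n) (half0 n)).
(* The three summands ensure smallness off {q n < 2 t n}, largeness on the layer (where
   [D <= s n / 2] for some centre), and decay near a point. The factor [n.+1] makes [kap n * d]
   exceed [Kc n] eventually for every fixed [d > 0]. *)
pose kap n := Kb n / s n + 2 * Ka n / s n + n.+1%:R * Kc n.
have kb0 n : 0 <= Kb n / s n by rewrite divr_ge0 ?(HKb n).1 // ltW.
have ka0 n : 0 <= 2 * Ka n / s n by rewrite divr_ge0 ?mulr_ge0 ?(HKa n).1 // ltW.
have kc0 n : 0 <= n.+1%:R * Kc n by rewrite mulr_ge0 ?(HKc n).1.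
have kap0 n : 0 <= kap n by rewrite !addr_ge0.
have kapb n : Kb n <= kap n * s n.
  by rewrite -ler_pdivrMr // /kap -addrA lerDl addr_ge0.
have kapa n : Ka n <= kap n * (s n / 2).
  rewrite mulrA ler_pdivlMr // mulrC -ler_pdivrMr //.
  by rewrite /kap addrAC lerDr addr_ge0.
have kapc n d : 1 <= n.+1%:R * d -> Kc n <= kap n * d.
  move=> nd; have d0 : 0 <= d.
    by rewrite -(@pmulr_rge0 _ n.+1%:R) // (le_trans ler01).
  apply: (@le_trans _ _ (n.+1%:R * Kc n * d)).
    by rewrite mulrAC ler_peMl // (HKc n).1.
  by rewrite ler_wpM2r // /kap lerDr addr_ge0.
pose psi n x : R^o := \sum_(0 <= k < m n) expR (kap n * (s n - D n k x)).
exists psi; split.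
- by move=> n x; apply: sumr_ge0 => k _; exact: expR_ge0.
- move=> n x qn qj; have [k km Dk] := (Hp n).2 x qn qj.
  have km' : (k.+1 <= m n)%N by [].
  rewrite /psi (big_cat_nat (n := k.+1)) //= big_nat_recr //=.
  apply: (@le_trans _ _ (expR (kap n * (s n - D n k x)))); last first.
    rewrite -addrA addrCA lerDl addr_ge0 // sumr_ge0 // => i _; exact: expR_ge0.
  have [_ Ha] := HKa n.
  apply: (Ha _ _).2; apply: le_trans (kapa n) _.
  rewrite ler_wpM2l //; move: Dk; rewrite -/(D n k x); lra.
- move=> n x qn.
  have le k : (k < m n)%N -> expR (kap n * (s n - D n k x)) <= expR (- (kap n * s n)).
    move=> km; rewrite ler_expR -mulrN ler_wpM2l //.
    suff : 2 * s n <= D n k x by lra.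
    apply: (@le_trans _ _ (t n ^+ 2)).
      by rewrite mulrC -ler_pdivlMr // ge_min lexx.
    rewrite /D big_nat_recr //= ler_wpDl ?sumr_ge0 // => [i _|]; first exact: sqr_ge0.
    have [pn _] := (Hp n).1 k km.
    have h : t n <= (q n x : R) - p n k n by lra.
    have tn := ltW (t0 n).
    by rewrite lerXn2r ?nnegrE // (le_trans tn).
  apply: (@le_trans _ _ (c n * expR (- (kap n * s n)))).
    rewrite /c mulrAC ler_wpM2r // /psi.
    apply: (@le_trans _ _ (\sum_(0 <= k < m n) expR (- (kap n * s n)))).
      rewrite big_nat_cond [leRHS]big_nat_cond.
      by apply: ler_sum => k /andP[/andP[_ km] _]; exact: le.
    by rewrite sumr_const_nat subn0 mulr_natl.
  by have [_ Hb] := HKb n; exact: (Hb _ (kapb n)).1.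
- move=> x0 j qj.
  pose d := (t j - q j x0 : R) ^+ 2.
  have d0 : 0 < d by rewrite exprn_gt0 // subr_gt0.
  (* With d / 24 the recentring costs 3 d / 24 = d / 8, well below the d / 2 that the distance to
     the net provides. *)
  have [r [N [r0 qN N2]]] := qW x0 (d / 24) (divr_gt0 d0 (ltr0n R 24)).
  (* Only the nets of index above [j] have j-th coordinates at least [t j], hence squared distance
     at least [d] from [x0]; the finitely many others get the trivial bound 0. *)
  pose dn n := if (j < n)%N then d else 0.
  pose B n := (m n)%:R * expR (kap n * (s n + 3 * (d / 24) - dn n / 2)).
  have Dd n k : (k < m n)%N -> dn n <= D n k x0.
    move=> km; rewrite /dn; case: ifP => jn; last first.
      by apply: sumr_ge0 => i _; exact: sqr_ge0.
    have [_ pj] := (Hp n).1 k km.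
    have jn' : (j.+1 <= n.+1)%N by rewrite ltnS ltnW.
    rewrite /D (big_cat_nat (n := j.+1)) //= big_nat_recr //=.
    have sq i : 0 <= (q i x0 - p n k i : R) ^+ 2 by exact: sqr_ge0.
    rewrite -addrA addrCA ler_wpDr ?addr_ge0 ?sumr_ge0 //.
    have pjt := pj j jn; have qj' : 0 <= t j - q j x0 :> R by rewrite subr_ge0 ltW.
    have h : t j - q j x0 <= p n k j - q j x0 :> R by lra.
    by rewrite -[leRHS]sqrrN opprB lerXn2r ?nnegrE // (le_trans qj').
  (* From [n0] on, [s n <= d / 8], so the exponent is at most [kap n] times d/8 + d/8 - d/2 = -
     d/4. *)
  pose n0 := maxn j.+1 (Num.truncn (8 / d)).
  have Bsum n : (n0 <= n)%N -> B n * (1 + w n) <= 2^-1 ^+ n.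
    rewrite geq_max => /andP[jn nd].
    have d8 : 8 / d < n.+1%:R.
      have /truncn_itv/andP[_] : 0 <= 8 / d by rewrite divr_ge0 // ltW.
      move=> h; apply: lt_le_trans h _; by rewrite ler_nat ltnS.
    have nd8 : 8 < n.+1%:R * d by rewrite -ltr_pdivrMr.
    have sn : s n <= d / 8.
      apply: (@le_trans _ _ n.+1%:R^-1); first by rewrite ge_min lexx orbT.
      by rewrite -[d / 8]invrK lef_pV2 ?posrE ?invr_gt0 ?divr_gt0 // invf_div ltW.
    have [_ Hc] := HKc n.
    have := (Hc (kap n * (d / 4)) (kapc n _ _)).1 => /(_ ltac:(lra)).
    apply: le_trans; rewrite /B mulrAC -/(c n) ler_wpM2l // ler_expR -[leRHS]mulrN ler_wpM2l //.
    rewrite /dn jn; lra.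
  have [S HS] := psum_bounded Bsum.
  exists r, B, S; split => // n.
  have -> : B n = \sum_(0 <= k < m n) expR (kap n * (s n + 3 * (d / 24) - dn n / 2)).
    by rewrite sumr_const_nat subn0 /B mulr_natl.
  apply: (@majorized_sum R X R^o) => k km.
  apply: majorizedW (majorized_gauss (p n k) (s n) r0 (kap0 n) qN (N2 n.+1)).
  rewrite ler_expR ler_wpM2l // lerD2l lerN2 ler_pM2r ?invr_gt0 //.
  exact: Dd.
Qed.

End Bumps.

(** * Approximation *)

Section Cover.
Set Implicit Arguments.
Unset Strict Implicit.
Unset Printing Implicit Defensive.
Context {R : realType} {X : normedModType R} {Y : completeNormedModType R}.

(** The approximation is a weighted mean of the [y n]. Weights with [q n x < 2 * t n] belong to
    values within eps / 2 of [f x]; the others are negligible against the denominator, which is at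
    least 1 + |y n| on the layer of [x] and thus controls the size of [f x]. *)
Lemma analytic_approx_of_cover (A : set X) (f : X -> Y) (eps : R)
    (q : nat -> X -> R^o) (t : nat -> R) (y : nat -> Y) :
  0 < eps ->
  (forall n x, 0 <= q n x :> R) -> (forall n, 0 < t n) ->
  (forall n, continuous (q n)) ->
  (forall x0 (e : R), 0 < e -> exists (r : R) (N : nat -> R),
    [/\ 0 < r, forall n, majorized x0 r (N n) (fun x => q n x - q n x0) &
        forall m, \sum_(0 <= n < m) N n ^+ 2 <= e]) ->
  (forall n j, exists C : R, forall x, q n x < t n :> R -> q j x <= C :> R) ->
  (forall x, A x -> exists n, q n x < t n :> R) ->
  (forall n x, A x -> q n x < 2 * t n :> R -> `|f x - y n| <= eps / 2) ->
  exists (Aeps : set X) (feps : X -> Y),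
    [/\ open Aeps, A `<=` Aeps, analytic_on Aeps feps &
        forall x, A x -> `|f x - feps x| < eps].
Proof.
move=> eps0 q0 t0 qc qW qB qA qf.
pose beta := eps / (4 * (1 + eps)).
have e1 : 0 < 1 + eps by rewrite addr_gt0.
have beta0 : 0 < beta by rewrite divr_gt0 // mulr_gt0.
have betaE : beta * (1 + eps) = eps / 4.
  by rewrite /beta; field; rewrite gt_eqF //; lra.
have [psi [psi0 psi_ge psi_le psi_maj]] :=
  analytic_bumps q0 t0 (fun n => normr_ge0 (y n)) beta0 qW qB.
pose G : set X := \bigcup_n (q n @^-1` [set z : R | z < t n]).
have first x : G x -> exists n, q n x < t n :> R /\ forall j, (j < n)%N -> t j <= q j x :> R.
  move=> [n0 _ /= qn0].
  have ex : exists n, (q n x : R) < t n by exists n0.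
  (* The least index whose set contains [x] determines the layer of [x]. *)
  case: (ex_minnP ex) => n qn min; exists n; split => // j jn.
  by rewrite leNgt; apply/negP => /min; rewrite leqNgt jn.
pose S x : R^o := limn (series (fun n => psi n x)).
pose T x : Y := limn (series (fun n => (psi n x : R) *: y n)).
have B0 a r (B : nat -> R) : (forall n, majorized a r (B n) (psi n)) -> forall n, 0 <= B n.
  by move=> H n; exact: majorized_ge0 (H n).
have loc a : G a -> exists r N : R, [/\ 0 < r, majorized a r N S, majorized a r N T,
    series (fun n => psi n a) @ \oo --> S a &
    series (fun n => (psi n a : R) *: y n) @ \oo --> T a].
  move=> [j _ /= qj]; have [r [B [N [r0 HB BN]]]] := psi_maj a j qj.
  have Bn := B0 _ _ _ HB.
  (* The weight 1 + |y n| dominates both 1 and |y n|, so one bound and one radius serve numerator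
     and denominator. *)
  have BN1 m : \sum_(0 <= n < m) B n <= N.
    apply: le_trans (BN m); apply: ler_sum => n _.
    by rewrite mulrDr mulr1 lerDl mulr_ge0.
  have BN2 m : \sum_(0 <= n < m) B n * `|y n| <= N.
    apply: le_trans (BN m); apply: ler_sum => n _.
    by rewrite mulrDr mulr1 lerDr.
  have HT n : majorized a r (B n * `|y n|) (fun x => (psi n x : R) *: y n).
    exact: majorizedM r0 (HB n) (majorized_cst a r (y n)).
  have r0' : `|0 : X| <= r by rewrite normr0 ltW.
  exists r, N; split => //.
  - exact: (@majorized_series R X R^o _ _ _ _ _ r0 HB BN1).
  - exact: (majorized_series r0 HT BN2).
  - apply: (series_dominated (V := R^o) _ BN1).1 => n.
    by have := majorized_norm (HB n) r0'; rewrite addr0.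
  - apply: (series_dominated _ BN2).1 => n.
    by have := majorized_norm (HT n) r0'; rewrite addr0.
have S_psum a K : G a -> \sum_(0 <= k < K) (psi k a : R) <= S a.
  move=> Ga; have [_ [_ [_ _ _ cS _]]] := loc a Ga.
  apply: (@nondecreasing_cvgn_le R (series (fun k => psi k a : R)) _ _ K).
    by apply: nondecreasing_series.
  by apply: cvgP; exact: cS.
have S_ge a n : G a -> q n a < t n :> R -> (forall j, (j < n)%N -> t j <= q j a :> R) ->
    1 + `|y n| <= S a :> R.
  move=> Ga qn qj; apply: le_trans (psi_ge n a qn qj) _.
  apply: le_trans (S_psum a n.+1 Ga).
  by rewrite big_nat_recr //= lerDr sumr_ge0.
have S_gt0 a : G a -> 0 < S a :> R.
  move=> Ga; have [n [qn qj]] := first a Ga.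
  by apply: lt_le_trans (S_ge a n Ga qn qj); rewrite ltr_pwDl.
have oG : open G.
  apply: bigcup_open => n _; apply: open_comp; last exact: open_lt.
  by move=> x _; exact: qc.
have AG : A `<=` G by move=> x /qA[n qn]; exists n.
exists G, (fun x => (S x : R)^-1 *: T x); split => //.
- apply: majorized_analytic => // a Ga.
  have [r [N [r0 HS HT _ _]]] := loc a Ga.
  have Sa : (S a : R) != 0 by rewrite gt_eqF // S_gt0.
  have [r' [N' [r'0 r'r HI]]] := majorized_inv r0 HS Sa.
  exists r', (N' * N); split => //.
  exact: (majorizedM r'0 HI (majorized_shrink (ltW r'0) r'r HT)).
- move=> x Ax; have Gx := AG x Ax.
  have [n [qn qj]] := first x Gx.
  have [_ [_ [_ _ _ cS cT]]] := loc x Gx.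
  have Sx := S_ge x n Gx qn qj.
  have S0 := S_gt0 x Gx.
  have fyn : `|f x - y n| <= eps / 2.
    by apply: qf => //; have := t0 n; lra.
  have fx : `|f x| <= `|y n| + eps.
    rewrite -[f x](subrKC (y n)) (le_trans (ler_normD _ _)) // lerD2l.
    by apply: le_trans fyn _; lra.
  (* |y k - f x| <= (1 + |y k|) c, and the factor 1 + |y k| is absorbed by the smallness of
     [psi k]. *)
  pose c := 1 + `|y n| + eps.
  have c0 : 0 <= c by rewrite !addr_ge0 // ltW.
  have half k : 0 <= (2^-1 : R) ^+ k by rewrite exprn_ge0.
  have term k : `|(psi k x : R) *: y k - (psi k x : R) *: f x| <=
      eps / 2 * psi k x + beta * 2^-1 ^+ k.+1 * c.
    rewrite -scalerBr normrZ ger0_norm //.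
    have [qk|qk] := ltP (q k x : R) (2 * t k).
      apply: ler_wpDr; first exact: mulr_ge0 (mulr_ge0 (ltW beta0) (half _)) c0.
      by rewrite mulrC distrC ler_wpM2r // qf.
    apply: ler_wpDl; first by rewrite mulr_ge0 // divr_ge0 // ltW.
    apply: (@le_trans _ _ ((psi k x : R) * (1 + `|y k|) * c)).
      rewrite -mulrA ler_wpM2l // (le_trans (ler_normB _ _)) //.
      rewrite /c; have := normr_ge0 (y k); have := normr_ge0 (y n); nra.
    by rewrite ler_wpM2r //; exact: psi_le.
  have diff : `|T x - (S x : R) *: f x| <= eps / 2 * S x + beta * c.
    have cv : (fun K => series (fun k => (psi k x : R) *: y k) K -
        (series (fun k => psi k x : R) K) *: f x) @ \oo --> T x - (S x : R) *: f x.
      by apply: cvgB => //; apply: cvgZl; exact: cS.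
    apply: (cvgn_norm_le cv) => K.
    rewrite /series /= scaler_suml -sumrB.
    apply: le_trans (ler_norm_sum _ _ _) _.
    apply: le_trans (ler_sum _ (fun k _ => term k)) _.
    rewrite big_split /= -mulr_sumr -mulr_suml -mulr_sumr; apply: lerD.
      by apply: ler_wpM2l; [rewrite divr_ge0 // ltW|exact: S_psum].
    apply: ler_wpM2r => //; rewrite -[leRHS]mulr1; apply: ler_wpM2l; first exact: ltW.
    have -> : \sum_(0 <= k < K) (2^-1 : R) ^+ k.+1 = 1 - 2^-1 ^+ K.
      elim: K => [|K IH]; first by rewrite big_geq // expr0 subrr.
      by rewrite big_nat_recr //= IH exprS; lra.
    by rewrite gerBl.
  have -> : f x - (S x : R)^-1 *: T x = (S x : R)^-1 *: ((S x : R) *: f x - T x).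
    by rewrite scalerBr scalerA mulVf ?scale1r // gt_eqF.
  rewrite normrZ ger0_norm ?invr_ge0 ?ltW // mulrC ltr_pdivrMr // distrC.
  apply: le_lt_trans diff _.
  (* [c <= (1 + eps) * S x], so the far terms cost at most a quarter of [eps * S x] and the total
     stays below three quarters. *)
  have bc : beta * c <= eps / 4 * S x.
    rewrite -betaE -mulrA; apply: ler_wpM2l; first exact: ltW.
    apply: (@le_trans _ _ ((1 + eps) * (1 + `|y n|))).
      by rewrite /c; have := normr_ge0 (y n); nra.
    by apply: ler_wpM2l; first exact: ltW.
  have := mulr_gt0 eps0 S0; lra.
Qed.

End Cover.

(** * Separating polynomials *)

Section Separation.
Set Implicit Arguments.
Unset Strict Implicit.
Unset Printing Implicit Defensive.
Context {R : realType} {X : normedModType R}.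

(** These are the features of a polynomial used later: one expression [K * (1 + s) ^+ d] bounds both
    the values and, up to the factor [r], the increments at any centre. *)
Definition poly_growth (q : X -> R^o) (K : R) (d : nat) : Prop :=
  [/\ 0 <= K, continuous q, forall x, `|q x| <= K * (1 + `|x|) ^+ d &
      forall (a : X) (r : R), 0 <= r -> r <= 1 ->
        majorized a r (r * (K * (1 + `|a|) ^+ d)) (fun x => q x - q a)].

Lemma poly_growth_hpoly n (M : R) (F : X -> R^o) :
  hpoly n M F -> poly_growth F ((n%:R + 1) * M) n.
Proof.
move=> FM; have M0 := hpoly_ge0 FM.
have pos (x : X) : 0 <= (1 + `|x|) ^+ n by rewrite exprn_ge0 // addr_ge0.
split.
- by rewrite mulr_ge0 // addr_ge0.
- exact: hpoly_continuous FM.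
- move=> x; apply: le_trans (hpoly_bound x FM) _; rewrite mulrDl mul1r mulrDl.
  rewrite ler_wpDl //; first by rewrite !mulr_ge0.
  by rewrite ler_wpM2l // lerXn2r ?nnegrE ?addr_ge0 // lerDr.
- move=> a r r0 r1; apply: majorizedW (majorized_sub_cst a r0 r1 FM).
  by rewrite ler_wpM2l // -mulrA mulrDl mul1r lerDl mulr_ge0.
Qed.

Lemma poly_growth_sum m (F : 'I_m -> X -> R^o) (P : pred 'I_m) :
  (forall i, P i -> exists K d, poly_growth (F i) K d) ->
  exists K d, poly_growth (fun x => \sum_(i < m | P i) F i x) K d.
Proof.
move=> HF.
suff H (s : seq 'I_m) : exists K d, poly_growth (fun x => \sum_(i <- s | P i) F i x) K d.
  exact: H.
elim: s => [|i s [K [d [K0 cq bq mq]]]].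
  exists 0, 0; split => // [|x|a r r0 r1].
  - rewrite (_ : (fun x => _) = fun=> 0); first by move=> x; exact: cvg_cst.
    by apply/funext => x; rewrite big_nil.
  - by rewrite big_nil normr0 mul0r.
  - rewrite mul0r mulr0 -(@normr0 _ R^o).
    apply: majorized_ext (majorized_cst a r (0 : R^o)) => v _.
    by rewrite !big_nil subrr.
have [Pi|nPi] := boolP (P i); last first.
  exists K, d; rewrite (_ : (fun x => _) = (fun x => \sum_(i <- s | P i) F i x)) //.
  by apply/funext => x; rewrite big_cons (negbTE nPi).
have [K' [d' [K'0 cF bF mF]]] := HF i Pi.
exists (K' + K), (d' + d)%N.
rewrite (_ : (fun x => _) = (fun x => F i x + \sum_(i <- s | P i) F i x)); last first.
  by apply/funext => x; rewrite big_cons Pi.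
have le (x : X) : K' * (1 + `|x|) ^+ d' + K * (1 + `|x|) ^+ d <=
    (K' + K) * (1 + `|x|) ^+ (d' + d).
  have x1 : 1 <= 1 + `|x| by rewrite lerDl.
  by rewrite mulrDl; apply: lerD; apply: ler_wpM2l => //;
    rewrite ler_weXn2l // ?leq_addr ?leq_addl.
split.
- exact: addr_ge0.
- by move=> x; apply: cvgD; [exact: cF|exact: cq].
- by move=> x; apply: le_trans (le x); apply: le_trans (ler_normD _ _) _; exact: lerD.
- move=> a r r0 r1.
  have := majorizedD (mF a r r0 r1) (mq a r r0 r1); rewrite -mulrDr => H.
  apply: majorized_ext (majorizedW (ler_wpM2l r0 (le a)) H) => v _.
  by rewrite /= addrACA -opprD.
Qed.

Lemma homogeneous_scale (Y : normedModType R) n (F : X -> Y) (c : R) x :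
  homogeneous_polynomial n F -> F (c *: x) = c ^+ n *: F x.
Proof.
move=> [_ [B linB FE]].
rewrite !FE (_ : [ffun=> c *: x] = [ffun j : 'I_n => c *: x]) //.
by rewrite (multilinear_scale_all (fun=> c) (fun=> x) linB) prodr_const card_ord.
Qed.

(** At each unit vector some part of positive degree is at least [c1], since the parts add up to at
    least [c0]. Homogeneity carries this to all radii, and squaring prevents cancellation between
    the parts. *)
Lemma separating_sum_of_squares (P : X -> R^o) : separating_polynomial P ->
  exists (q : X -> R^o) (K : R) (d : nat),
    [/\ poly_growth q K d, forall x, 0 <= q x :> R, q 0 = 0 &
        forall e : R, 0 < e -> exists2 c : R, 0 < c &
          forall x, e <= `|x| -> c <= q x :> R].
Proof.
move=> [[m [deg [F [homF PE]]]] P0 infP].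
have [c0 c0_gt0 Pc0] : exists2 c : R, 0 < c & forall u, `|u| = 1 -> c <= P u :> R.
  have lb u : `|u| = 1 -> (ereal_inf [set (P x)%:E | x in [set x : X | `|x|%R = 1%R]]
      <= (P u : R)%:E)%E.
    by move=> u1; apply: ereal_inf_lbound; exists u.
  case: (ereal_inf _) infP lb => [r||] //.
    rewrite lte_fin => r0 lb; exists r => // u /lb; by rewrite lee_fin.
  (* The infimum is +oo only if there is no unit vector, and then any positive constant works. *)
  by move=> _ lb; exists 1 => // u /lb.
pose pos i := (0 < deg i)%N.
have F0 i : pos i -> F i 0 = 0.
  rewrite /pos => di; have := homogeneous_scale 0 0 (homF i).
  by rewrite scaler0 expr0n eqn0Ngt di scale0r.
have PE' x : P x = \sum_(i < m | pos i) F i x.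
  have cst i : ~~ pos i -> F i x - F i 0 = 0.
    rewrite -leqNgt leqn0 => /eqP di.
    by have := homogeneous_scale 0 x (homF i); rewrite scale0r di expr0 scale1r => ->; rewrite subrr.
  have -> : P x = P x - P 0 by rewrite P0 subr0.
  rewrite !PE -sumrB (bigID pos) /= [X in _ + X]big1 // addr0.
  by apply: eq_bigr => i /F0 ->; rewrite subr0.
pose q x : R^o := \sum_(i < m | pos i) (F i x : R) ^+ 2.
have [K [d qK]] : exists K d, poly_growth q K d.
  apply: poly_growth_sum => i _; have [M FM] := homogeneous_hpoly (homF i).
  have F2 := hpolyM FM FM.
  by exists (((deg i + deg i)%N%:R + 1) * (M * M)), (deg i + deg i)%N; exact: poly_growth_hpoly.
exists q, K, d; split => //.
- by move=> x; apply: sumr_ge0 => i _; exact: sqr_ge0.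
- by rewrite /q big1 // => i /F0 ->; rewrite expr0n.
move=> e e0.
pose e' := Num.min 1 e.
have e'0 : 0 < e' by rewrite lt_min ltr01.
have e'1 : e' <= 1 by rewrite ge_min lexx.
(* [D] bounds every degree and [e' <= 1], so [e' ^+ D] is a lower bound common to all parts.
   Dividing by [m.+1] makes [m] times [c1] strictly less than [c0]. *)
pose D := (\sum_(i < m) deg i)%N.
pose c1 := c0 / m.+1%:R.
have c10 : 0 < c1 by rewrite divr_gt0.
exists ((e' ^+ D * c1) ^+ 2); first by rewrite exprn_gt0 // mulr_gt0 // exprn_gt0.
move=> x ex.
have x0 : 0 < `|x| by exact: lt_le_trans ex.
pose u := `|x|^-1 *: x.
have u1 : `|u| = 1 by rewrite normrZ normfV normr_id mulVf // gt_eqF.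
have xu : x = `|x| *: u by rewrite scalerA divff ?scale1r // gt_eqF.
have [i pi ci] : exists2 i, pos i & c1 <= F i u :> R.
  apply: contrapT => H.
  have Fi i : pos i -> F i u <= c1 :> R.
    by move=> pi; rewrite leNgt; apply/negP => ci; apply: H; exists i => //; exact: ltW.
  have : c0 <= \sum_(i < m | pos i) c1.
    by apply: le_trans (Pc0 u u1) _; rewrite PE'; exact: ler_sum.
  have : \sum_(i < m | pos i) c1 <= \sum_(i < m) c1.
    by rewrite [leRHS](bigID pos) /= lerDl sumr_ge0 // => i _; exact: ltW.
  have -> : \sum_(i < m) c1 = c1 * m%:R by rewrite sumr_const card_ord mulr_natr.
  move=> h1 h2; have := le_trans h2 h1.
  rewrite /c1 mulrAC ler_pdivlMr // leNgt => /negP; apply.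
  by rewrite ltr_pM2l // ltr_nat.
rewrite /q (bigD1 i) //= ler_wpDr //; first by apply: sumr_ge0 => j _; exact: sqr_ge0.
rewrite xu (homogeneous_scale _ _ (homF i)) /GRing.scale /=.
have p0 : 0 <= e' ^+ D * c1 by rewrite mulr_ge0 ?exprn_ge0 // ltW.
suff h : e' ^+ D * c1 <= `|x| ^+ deg i * F i u.
  by rewrite lerXn2r ?nnegrE // (le_trans p0).
apply: ler_pM => //; first by rewrite exprn_ge0 // ltW.
  exact: ltW.
apply: (@le_trans _ _ (e' ^+ deg i)).
  apply: ler_wiXn2l => //; first exact: ltW.
  by rewrite /D (bigD1 i) //= leq_addr.
rewrite lerXn2r ?nnegrE //; first exact: ltW.
by apply: le_trans ex; rewrite ge_min lexx orbT.
Qed.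

Lemma majorized_translate (Y : normedModType R) (a b : X) (r N : R) (h : X -> Y) :
  majorized (a - b) r N h -> majorized a r N (fun x => h (x - b)).
Proof.
move=> [F [M [FM MN Fh]]]; exists F, M; split => // v vr.
by rewrite addrAC; exact: Fh.
Qed.

Lemma countable_range (T : Type) (S : set T) : countable S -> S !=set0 ->
  exists2 e : nat -> T, forall n, S (e n) & forall x, S x -> exists n, e n = x.
Proof.
move=> /countable_injP[g ginj] [x0 Sx0].
have H n : exists x, S x /\ forall y, S y -> g y = n -> x = y.
  have [[x [Sx gx]]|nx] := pselect (exists x, S x /\ g x = n).
    exists x; split => // y Sy gy; apply: ginj; rewrite ?inE //.
    by rewrite gx gy.
  by exists x0; split => // y Sy gy; case: nx; exists y.
have [e He] := choice H; exists e => [n|x Sx]; first exact: (He n).1.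
by exists (g x); exact: (He (g x)).2.
Qed.

End Separation.

(** * Summable rescaling of the translates *)

Section Rescaling.
Set Implicit Arguments.
Unset Strict Implicit.
Unset Printing Implicit Defensive.
Context {R : realType} {X : normedModType R}.

Lemma rescaled_translates (q : X -> R^o) (K : R) (d : nat) (b : nat -> X) (c : nat -> R) :
  poly_growth q K d -> (forall n, 0 <= c n) ->
  exists w : nat -> R, (forall n, 0 < w n) /\
    forall x0 (e : R), 0 < e -> exists (r : R) (N : nat -> R),
      [/\ 0 < r,
          forall n, majorized x0 r (N n)
            (fun x => w n * (c n * q (x - b n)) - w n * (c n * q (x0 - b n)) : R^o) &
          forall m, \sum_(0 <= n < m) N n ^+ 2 <= e].
Proof.
move=> [K0 cq bq mq] c0.
pose g n (s : R) := c n * (K * (1 + s) ^+ d).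
have g0 n s : 0 <= s -> 0 <= g n s.
  by move=> s0; rewrite !mulr_ge0 // exprn_ge0 // addr_ge0.
(* As soon as |x0| <= n, the norm of [x0 - b n] is at most n + |b n|. The weights thus do not depend
   on [x0], and yet [Z n <= 2^-1 ^+ n] for all large [n]. *)
pose w n := 2^-1 ^+ n / (1 + g n (n%:R + `|b n|)).
have G0 n : 0 < 1 + g n (n%:R + `|b n|) by rewrite ltr_pwDl // g0 // addr_ge0.
have w0 n : 0 < w n by rewrite divr_gt0 // exprn_gt0 // invr_gt0.
exists w; split => // x0 e e0.
pose Z n := w n * g n `|x0 - b n|.
have Z0 n : 0 <= Z n by rewrite mulr_ge0 ?g0 // ltW.
have Z2 n : (Num.truncn `|x0| < n)%N -> Z n ^+ 2 <= 2^-1 ^+ n.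
  move=> xn.
  have x0n : `|x0| <= n%:R.
    have /truncn_itv/andP[_ h] := normr_ge0 x0.
    by apply: le_trans (ltW h) _; rewrite ler_nat.
  have Zn : Z n <= 2^-1 ^+ n.
    rewrite /Z /w mulrAC -mulrA ler_piMr ?exprn_ge0 // ler_pdivrMr // mul1r.
    apply: (@le_trans _ _ (g n (n%:R + `|b n|))); last by rewrite lerDr.
    rewrite ler_wpM2l // ler_wpM2l // lerXn2r ?nnegrE ?addr_ge0 // lerD2l.
    by rewrite (le_trans (ler_normB _ _)) // lerD2r.
  rewrite expr2; apply: le_trans (ler_pM (Z0 n) (Z0 n) Zn Zn) _.
  by rewrite ler_piMr ?exprn_ge0 // exprn_ile1 // invf_le1 // ler1n.
have [N HN] := psum_bounded Z2.
have N0 : 0 <= N by have := HN 0; rewrite big_geq.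
(* Since [r <= 1], the sum of the squares is at most r^2 N <= r N <= e. *)
pose r := Num.min 1 (e / (1 + N)).
have r0 : 0 < r by rewrite lt_min ltr01 divr_gt0 // ltr_pwDl.
have r1 : r <= 1 by rewrite ge_min lexx.
have rN : r * N <= e.
  apply: (@le_trans _ _ (e / (1 + N) * N)).
    by rewrite ler_wpM2r // ge_min lexx orbT.
  by rewrite mulrAC ler_pdivrMr ?ltr_pwDl // ler_wpM2l ?lerDr // ltW.
exists r, (fun n => r * Z n); split => //.
- move=> n.
  have wc : 0 <= w n * c n by rewrite mulr_ge0 // ltW.
  have := majorizedM (Z := R^o) r0 (majorized_cst x0 r (w n * c n : R^o))
    (majorized_translate (mq (x0 - b n) r (ltW r0) r1)).
  have -> : `|w n * c n : R^o| * (r * (K * (1 + `|x0 - b n|) ^+ d)) = r * Z n.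
    by rewrite ger0_norm // /Z /g; ring.
  apply: majorized_ext => v _.
  by rewrite /GRing.scale /= mulrBr !mulrA.
- move=> m; under eq_bigr do rewrite exprMn.
  rewrite -mulr_sumr expr2 -mulrA.
  apply: le_trans rN; apply: le_trans (_ : r * (\sum_(0 <= i < m) Z i ^+ 2) <= _); last first.
    by apply: ler_wpM2l; [exact: ltW|exact: HN].
  apply: ler_wpM2l; first exact: ltW.
  by apply: ler_piMl => //; apply: sumr_ge0 => i _; exact: sqr_ge0.
Qed.

End Rescaling.

(** * Countable cover of the domain and assembly of the approximation *)

Theorem theorem3 (R : realType) (X : normedModType R)
    (Y : completeNormedModType R)
    (sepX : separable X)
    (sepP : exists P : X -> R^o, separating_polynomial P)
    (A : set X) (f : X -> Y) (f_cont : {within A, continuous f})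
    (eps : R) (eps_gt0 : 0 < eps) :
  exists (Aeps : set X) (feps : X -> Y),
    [/\ open Aeps, A `<=` Aeps, analytic_on Aeps feps &
        forall x, A x -> `|f x - feps x| < eps].
Proof.
(* The enumeration of the good pairs below needs one to exist, which a point of [A] provides. *)
have [[a0 Aa0]|/set0P/negP/negPn/eqP A0] := pselect (A !=set0); last first.
  exists set0, f; split => //; first exact: open0.
    by rewrite A0.
  by move=> x; rewrite A0.
have [P sP] := sepP.
have [q [K [d [qK q0 q00 qsep]]]] := separating_sum_of_squares sP.
have [K0 cq bq _] := qK.
have [D cD dD] := sepX.
have e2 : 0 < eps / 2 by rewrite divr_gt0.
(* A good pair is a centre and an integer scale whose level set lies in a unit ball and carries a
   nearly constant [f]. Integer scales and centres in [D] leave only countably many pairs. *)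
pose good : set (X * nat) := [set p | [/\ D p.1,
  forall x, p.2%:R * q (x - p.1) < 1 :> R -> `|x - p.1| <= 1 &
  exists y : Y, forall x, A x -> p.2%:R * q (x - p.1) < 1 :> R -> `|f x - y| <= eps / 2]].
have cgood : countable good.
  apply: (@sub_countable _ _ _ (D `*` [set: nat])).
    by apply: subset_card_le => p [].
  by apply: countableX => //; exact: countable_setT.
have cover a : A a -> exists2 p, good p & p.2%:R * q (a - p.1) < 1 / 2 :> R.
  move=> Aa.
  have [rho rho0 frho] : exists2 rho : R, 0 < rho &
      forall x, A x -> `|x - a| < rho -> `|f x - f a| <= eps / 2.
    have /cvgrPdist_le/(_ _ e2) := (subspace_continuousP A f).1 f_cont a Aa.
    move=> /nbhs_normP[rho /= rho0 H]; exists rho => // x Ax xa.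
    by rewrite distrC; apply: H => //=; rewrite distrC.
  (* Two distances below rho / 2, from [x] to [b] and from [b] to [a], keep [x] within [rho] of
     [a]. *)
  pose de := Num.min (rho / 2) 1.
  have de0 : 0 < de by rewrite lt_min ltr01 divr_gt0.
  have [c1 c10 qc1] := qsep de de0.
  pose c := (Num.truncn c1^-1).+1.
  have c0 : (0 : R) < c%:R by rewrite ltr0n.
  have cc1 : 1 <= c%:R * c1.
    have /truncn_itv/andP[_ h] : 0 <= c1^-1 by rewrite invr_ge0 ltW.
    by rewrite -ler_pdivrMr // mul1r ltW.
  have small z : c%:R * q z < 1 :> R -> `|z| < de.
    move=> qz; rewrite ltNge; apply/negP => /qc1 c1z.
    have : c%:R * c1 <= c%:R * q z :> R by rewrite ler_pM2l.
    by move=> h; have := le_lt_trans (le_trans cc1 h) qz; rewrite ltxx.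
  (* Continuity of [q] at 0 lets a centre near [a] put [a] in the half-level set. *)
  have [r' r'0 qr'] : exists2 r' : R, 0 < r' & forall z, `|z| < r' -> q z < (2 * c%:R)^-1 :> R.
    have c2 : 0 < (2 * c%:R)^-1 :> R by rewrite invr_gt0 mulr_gt0.
    have /cvgrPdist_lt/(_ _ c2)/nbhs_norm0P[r' /= r'0 H] := cq 0.
    exists r' => // z zr; have := H z zr; rewrite /= q00 sub0r normrN.
    exact: le_lt_trans (ler_norm _).
  pose O := [set x : X | `|a - x| < Num.min r' de].
  have m0 : 0 < Num.min r' de by rewrite lt_min r'0.
  have [b [Ob Db]] : O `&` D !=set0.
    apply: dD; first by exists a; rewrite /O /= subrr normr0.
    by rewrite (_ : O = ball a (Num.min r' de)); [exact: ball_open|rewrite -ball_normE].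
  move: Ob; rewrite /O /= lt_min => /andP[abr abd].
  exists (b, c) => /=; last first.
    apply: (@lt_le_trans _ _ (c%:R * (2 * c%:R)^-1)); first by rewrite ltr_pM2l // qr'.
    by rewrite invfM mulrCA divff ?gt_eqF // mulr1 div1r.
  split => //=.
    by move=> x /small/ltW xb; apply: le_trans xb _; rewrite ge_min lexx orbT.
  exists (f a) => x Ax /small xb; apply: frho => //.
  rewrite -(subrKA b) (le_lt_trans (ler_normD _ _)) // [`|b - a|]distrC.
  have h : de <= rho / 2 by rewrite ge_min lexx.
  have := lt_le_trans xb h; have := lt_le_trans abd h; lra.
have good0 : good !=set0 by have [p gp _] := cover a0 Aa0; exists p.
have [e eg ege] := countable_range cgood good0.
pose b n := (e n).1; pose c n : R := (e n).2%:R.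
have c0 n : 0 <= c n by [].
have [y Hy] : exists y : nat -> Y, forall n x, A x -> c n * q (x - b n) < 1 :> R ->
    `|f x - y n| <= eps / 2.
  have H n : exists y : Y, forall x, A x -> c n * q (x - b n) < 1 :> R ->
    `|f x - y| <= eps / 2 by have [] := eg n.
  by have [y Hy] := choice H; exists y.
have [w [w0 wmaj]] := rescaled_translates b qK c0.
(* With [t n = w n / 2], the sets {q n < t n} and {q n < 2 t n} are the levels 1/2 and 1 of the
   unweighted functions. *)
apply: (@analytic_approx_of_cover R X Y A f eps
  (fun n x => w n * (c n * q (x - b n)) : R^o) (fun n => w n / 2) y) => //.
- by move=> n x; rewrite !mulr_ge0 // ltW.
- by move=> n; rewrite divr_gt0.
- move=> n x; apply: cvgMr; apply: cvgMr.
  apply: continuous_comp; last exact: cq.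
  by apply: cvgB; [exact: cvg_id|exact: cvg_cst].
(* The level set lies in the unit ball around [b n], so [x - b j] has norm at most 1 + |b n| + |b j|
   there. *)
- move=> n j; exists (w j * (c j * (K * (1 + (1 + `|b n| + `|b j|)) ^+ d))) => x qx.
  have xb : `|x - b n| <= 1.
    have [_ + _] := eg n; apply; rewrite -(ltr_pM2l (w0 n)) mulr1.
    by apply: lt_trans qx _; have := w0 n; lra.
  apply: ler_wpM2l; first exact: ltW.
  apply: ler_wpM2l => //; apply: le_trans (ler_norm _) _.
  apply: le_trans (bq _) _; apply: ler_wpM2l => //.
  rewrite lerXn2r ?nnegrE ?addr_ge0 // lerD2l.
  rewrite -[x](subrK (b n)) -[X in `|X|]addrA (le_trans (ler_normD _ _)) //.
  by rewrite -[leRHS]addrA lerD // ler_normB.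
- move=> x /cover[p gp qp]; have [n en] := ege p gp; exists n.
  by rewrite /b /c en ltr_pM2l // -[2^-1]div1r.
- move=> n x Ax qx; apply: Hy => //.
  have w2 : 2 * (w n / 2) = w n * 1 by field.
  by move: qx; rewrite w2 ltr_pM2l.
Qed.
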